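(* Let $\delta_0>0$, $c_0<\infty$, and let $a\in[0,1]^{\mathbb{Z}}$ be irreducible and aperiodic. Let $\alpha\in[0,2/3)$. Then there exist $n_0\geq 1$ and $C\geq 0$ such that for any independent sequence $X_1,X_2,\dots$ of $\mathbb{Z}$-valued random variables with laws in $\mathcal{M}_{\delta_0,c_0}^a$ the following holds. For any $n\geq n_0$ and any $y\in\mathbb{Z}$ with $|y-m_n|\leq n^{\alpha}$, $$\exp\bigl(-Cn^{-\min(2-3\alpha,1/3)}\bigr)\leq \sqrt{2\pi B_n}\,e^{(y-m_n)^2/(2B_n)}\,P_0(S_n=y)\leq \exp\bigl(Cn^{-\min(2-3\alpha,1/3)}\bigr),$$ where $m_k=\sum_{i=1}^k E(X_i)=E_0(S_k)$ and $B_k=\sum_{i=1}^k \mathrm{Var}(X_i)$.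
   Context: Under $P_u$ (expectation $E_u$) the walk is $S_0=u$, $S_n=u+X_1+\dots+X_n$. $\mathcal{M}_{\mathbb{Z}}$ is the set of probability measures on $\mathbb{Z}$; $p(i)$ is the mass of $p$ at $i$. A measure $p\in\mathcal{M}_{\mathbb{Z}}$ is called irreducible (resp. aperiodic) if the random walk on $\mathbb{Z}$ with i.i.d. steps of law $p$ is an irreducible (resp. aperiodic) Markov chain. A sequence $a=(a_i)_{i\in\mathbb{Z}}\in[0,1]^{\mathbb{Z}}$ is irreducible and aperiodic if there are an irreducible and aperiodic $p\in\mathcal{M}_{\mathbb{Z}}$ and numbers $b_i>0$, $i\in\mathbb{Z}$, with $a_i=b_ip(i)$ for all $i$. For $\delta,c>0$, $$\mathcal{M}_{\delta,c}^a=\Bigl\{p\in\mathcal{M}_{\mathbb{Z}}:\ \sup_{|t|\leq\delta}\sum_{k\in\mathbb{Z}}p(k)e^{tk}\leq c,\ p(i)\geq a_i\ \forall i\in\mathbb{Z}\Bigr\}.$$ *)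

(* Defs.v *)
From HB Require Import structures.
From mathcomp Require Import all_boot all_order all_algebra.
From mathcomp Require Import finmap.
From mathcomp Require Import all_classical all_reals all_analysis.

Set Implicit Arguments.
Unset Strict Implicit.
Unset Printing Implicit Defensive.

Import Order.TTheory GRing.Theory Num.Theory.
Import numFieldNormedType.Exports.

Local Open Scope classical_set_scope.
Local Open Scope ring_scope.

(* [int] carries the discrete sigma-algebra, as the library does for [nat]. *)
HB.instance Definition _ := isPointed.Build int 0.
HB.instance Definition _ := @isMeasurable.Build default_measure_display
  int discrete_measurable discrete_measurable0
  discrete_measurableC discrete_measurableU.

Section markov_chain.
Context {R : realType} {T : choiceType}.
Implicit Type K : T -> T -> \bar R.

Fixpoint nstep K (n : nat) (x y : T) : \bar R :=
  if n is n'.+1 then (\esum_(z in [set: T]) (K x z * nstep K n' z y))%E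
  else (x == y)%:R%:E.

Definition irreducible_chain K : Prop :=
  forall x y, exists n : nat, (0 < nstep K n x y)%E.

(* Every state has period 1: the return times [n >= 1] have greatest common
   divisor 1.  A state without return times is not aperiodic. *)
Definition aperiodic_chain K : Prop :=
  forall x (q : nat),
    (forall n : nat, (0 < n)%N -> (0 < nstep K n x x)%E -> (q %| n)%N) ->
    q = 1%N.

End markov_chain.

Section steps.
Context {R : realType}.
Implicit Types (p : probability int R) (a : int -> R).

Definition walk_kernel p (x y : int) : \bar R := p [set y - x].

Definition irreducible_measure p : Prop := irreducible_chain (walk_kernel p).

Definition aperiodic_measure p : Prop := aperiodic_chain (walk_kernel p).

Definition irreducible_aperiodic_seq a : Prop :=
  exists p : probability int R,
    [/\ irreducible_measure p, aperiodic_measure p &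
      exists b : int -> R, (forall i, 0 < b i) /\
        forall i, (a i)%:E = ((b i)%:E * p [set i])%E].

Definition exp_moment p (t : R) : \bar R :=
  (\esum_(k in [set: int]) (p [set k] * (expR (t * k%:~R))%:E))%E.

Definition step_laws (delta c : R) a : set (probability int R) :=
  [set p | (ereal_sup [set exp_moment p t | t in [set t : R | (`|t| <= delta)%R]]
              <= c%:E)%E
           /\ forall i, ((a i)%:E <= p [set i])%E].

End steps.

Section walk.
Context {R : realType} {d : measure_display} {T : measurableType d}
  (P : probability T R).

Definition mutually_independent {I : choiceType} {d' : measure_display}
    {T' : measurableType d'} (X : I -> {RV P >-> T'}) : Prop :=
  forall (J : {fset I}) (A : I -> set T'),
    (forall i, measurable (A i)) ->
    P (\bigcap_(i in [set` J]) (X i @^-1` A i)) =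
    (\prod_(i <- J) P (X i @^-1` A i))%E.

(* The increments [X_1, X_2, ...] are indexed from 0: [X i] is [X_{i+1}]. *)
Implicit Type X : nat -> {RV P >-> int}.

Definition walk (u : int) X (n : nat) (w : T) : int := u + \sum_(i < n) X i w.

(* The moments are finite as soon as the laws lie in some [step_laws delta c a]
   with [0 < delta], so that [fine] loses nothing. *)
Definition walk_mean X (n : nat) : R :=
  \sum_(i < n) fine ('E_P[fun w => (X i w)%:~R : R])%E.

Definition walk_variance X (n : nat) : R :=
  \sum_(i < n) fine ('V_P[fun w => (X i w)%:~R : R])%E.

End walk.

(* Main.v *)
Require Import Defs.
From mathcomp Require Import all_boot all_order all_algebra.
From mathcomp Require Import finmap complex ring lra.
From mathcomp Require Import all_classical all_reals all_analysis.
From mathcomp Require Import measurable_realfun.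

(** The proof inverts a Fourier transform along a shifted contour.  Put
    [x = y - m_n], [B = B_n], [t = x / B] and let
    [f_j z = E exp (z (X_j - E X_j))].  Then

      [2 pi exp (t x) P (S_n = y)
         = integral over |th| <= pi of exp (- i th x) prod_j f_j (t + i th)].

    Up to [O(|z|^3)], uniformly over the class of laws, [f_j z] is
    [exp (s_j z^2 / 2)] with [s_j = Var X_j] ([laplace_near_gaussian]).  If all
    factors are replaced by these, the integrand becomes
    [exp (B t^2 / 2 - B th^2 / 2 + i th (B t - x))]; the choice of [t] makes the
    oscillating term vanish, and the Gaussian integral is the main term of the
    theorem.  So [t] need not be the exact saddle point: the third-order error
    that this costs is of the size of the error allowed.

    The factors are replaced one at a time ([normc_prod_sub]).  The cost of
    this is summable because every factor, old or new, is at most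
    [exp (s_j t^2 / 2 + O(|t|^3) - c th^2)] for all [|th| <= pi]
    ([step_factors]).  After integration the relative error is
    [O(n |t|^3 + n^(-1/2))] ([finite_local_limit]).  Since [B >= v n] and
    [|x| <= n^alpha], the first term is [O(n^(3 alpha - 2))]
    ([rate_bounds]).

    The bound on the factors away from [th = 0] is where irreducibility and
    aperiodicity enter.  With [q k = P (X_j = k) exp (t (k - E X_j))] one has
    [|f_j (t + i th)|^2 = f_j t ^2 - sum_(k, l) q k q l (1 - cos ((k - l) th))].
    The differences of the support generate the group of integers
    ([subgroup_support_differences]), and [1 - cos] is subadditive up to a
    constant, so finitely many terms of the double sum already dominate
    [1 - cos th], hence [th^2] ([aperiodic_spread]).  The lower bound
    [P (X_j = k) >= a k] makes this uniform, and it also bounds the variances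
    from below ([variance_ge]).

    Laws on the integers are first truncated to a box [-K .. K - 1].
    Independence, Fourier inversion and the product of the [f_j] are then
    statements about finite sums.  The exponential moments make the truncation
    error of the first two moments as small as desired
    ([regular_box_step]), and [K] goes to infinity only in the final estimate
    ([cvg_walk_box]). *)

Set Implicit Arguments.
Unset Strict Implicit.
Unset Printing Implicit Defensive.

Import Order.TTheory GRing.Theory Num.Theory.
Import numFieldNormedType.Exports.

Local Open Scope classical_set_scope.
Local Open Scope ring_scope.

(** * Taylor bounds for exp, sin and cos *)

Section taylor_bounds.
Context {R : realType}.
Implicit Types a b x u : R.

Lemma mean_value_bound (f df : R -> R) (M a : R) :
  (forall x, is_derive x 1 f (df x)) ->
  (forall x, `|x| <= `|a| -> `|df x| <= M) ->
  `|f a - f 0| <= M * `|a|.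
Proof.
move=> fdf dfM.
have fc x y : {within `[x, y], continuous f}.
  apply: derivable_within_continuous => z _.
  exact: (@ex_derive _ _ _ _ _ _ _ (fdf z)).
have [a0|a0] := leP 0 a.
  have [c] := MVT_segment a0 (fun x _ => fdf x) (fc 0 a).
  rewrite in_itv/= => /andP[c0 ca] ->; rewrite subr0 normrM ler_wpM2r//.
  by apply: dfM; rewrite !ger0_norm.
have [c] := MVT_segment (ltW a0) (fun x _ => fdf x) (fc a 0).
rewrite in_itv/= => /andP[ac c0].
rewrite -normrN opprB => ->; rewrite sub0r normrM normrN ler_wpM2r//.
by apply: dfM; rewrite !ler0_norm ?lerN2// ltW.
Qed.

(** Each of the next two bounds follows from the preceding one, applied to the
    derivative. *)
Lemma expR_taylor1 a : `|expR a - 1| <= `|a| * expR `|a|.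
Proof.
rewrite -expR0 mulrC; apply: mean_value_bound => x xa.
by rewrite ger0_norm ?expR_ge0// ler_expR (le_trans _ xa)// ler_norm.
Qed.

Lemma expR_taylor2 a : `|expR a - 1 - a| <= `|a| ^+ 2 * expR `|a|.
Proof.
have -> : expR a - 1 - a = (expR a - a) - (expR 0 - 0).
  by rewrite expR0; ring.
rewrite expr2 mulrAC.
apply: (@mean_value_bound (fun x => expR x - x) (fun x => expR x - 1)).
by move=> x xa; rewrite (le_trans (expR_taylor1 _))// ler_pM// ler_expR.
Qed.

Lemma expR_taylor3 a :
  `|expR a - 1 - a - a ^+ 2 / 2| <= `|a| ^+ 3 * expR `|a|.
Proof.
have -> : expR a - 1 - a - a ^+ 2 / 2 =
    (expR a - a - a ^+ 2 / 2) - (expR 0 - 0 - 0 ^+ 2 / 2).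
  by rewrite expR0; ring.
have -> : `|a| ^+ 3 * expR `|a| = (`|a| ^+ 2 * expR `|a|) * `|a| by ring.
apply: (@mean_value_bound (fun x => expR x - x - x ^+ 2 / 2)
  (fun x => expR x - 1 - x)).
  move=> x; apply: is_derive_eq.
  by rewrite /GRing.scale/= !(mulr0, mulr1, add0r, addr0); field.
move=> x xa; rewrite (le_trans (expR_taylor2 _))// ler_pM// ?ler_expR//.
by rewrite lerXn2r.
Qed.

Lemma sin_le_norm a : `|sin a| <= `|a|.
Proof.
have := @mean_value_bound sin cos 1 a _ (fun x _ => cos_max x).
by rewrite sin0 subr0 mul1r; apply => x.
Qed.

Lemma one_sub_cos u : 1 - cos u = 2 * sin (u / 2) ^+ 2.
Proof.
have -> : cos u = cos (u / 2 *+ 2) by congr cos; rewrite -mulr_natr; field.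
by rewrite cos_mulr2n cos2sin2; ring.
Qed.

Lemma one_sub_cos_ge0 u : 0 <= 1 - cos u.
Proof. by rewrite subr_ge0 cos_le1. Qed.

Lemma one_sub_cos_le u : 1 - cos u <= u ^+ 2 / 2.
Proof.
rewrite one_sub_cos; have := sin_le_norm (u / 2).
rewrite -(ler_pXn2r (n := 2))// ?nnegrE// !real_normK ?num_real//.
by lra.
Qed.

Lemma sin_taylor3 a : `|sin a - a| <= `|a| ^+ 3 / 2.
Proof.
have -> : sin a - a = (sin a - a) - (sin 0 - 0) by rewrite sin0; ring.
have -> : `|a| ^+ 3 / 2 = (`|a| ^+ 2 / 2) * `|a| by ring.
apply: (@mean_value_bound (fun x => sin x - x) (fun x => cos x - 1)).
move=> x xa; rewrite -normrN opprB ger0_norm ?one_sub_cos_ge0//.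
rewrite (le_trans (one_sub_cos_le _))// ler_wpM2r// -real_normK ?num_real//.
by rewrite lerXn2r.
Qed.

Lemma sin_taylor2 a : `|sin a - a| <= `|a| ^+ 2.
Proof.
have -> : sin a - a = (sin a - a) - (sin 0 - 0) by rewrite sin0; ring.
rewrite expr2.
apply: (@mean_value_bound (fun x => sin x - x) (fun x => cos x - 1)).
move=> x xa; rewrite (le_trans _ xa)//.
have := @mean_value_bound cos (fun x => - sin x) 1 x.
rewrite cos0 mul1r; apply => z; rewrite normrN.
by move=> _; exact: sin_max.
Qed.

Lemma cos_taylor3 a : `|cos a - 1 + a ^+ 2 / 2| <= `|a| ^+ 3.
Proof.
have -> : cos a - 1 + a ^+ 2 / 2 =
  (cos a + a ^+ 2 / 2) - (cos 0 + 0 ^+ 2 / 2) by rewrite cos0; ring.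
have -> : `|a| ^+ 3 = `|a| ^+ 2 * `|a| by ring.
apply: (@mean_value_bound (fun x => cos x + x ^+ 2 / 2) (fun x => x - sin x)).
  move=> x; apply: is_derive_eq.
  by rewrite /GRing.scale/= !(mulr0, mulr1, add0r, addr0); field.
move=> x xa; rewrite -normrN opprB (le_trans (sin_taylor2 _))//.
by rewrite lerXn2r.
Qed.

(** Halving the angle twice brings it below [pi / 4 <= 1], where the Taylor
    bounds give [sin h >= h / 2] and [cos h >= 1 / 2]. *)
Lemma one_sub_cos_ge u : `|u| <= pi -> u ^+ 2 / 32 <= 1 - cos u.
Proof.
move=> upi.
suff H (h : R) : 0 <= h <= 1 -> h / 2 <= sin (h *+ 2).
  have hu : 0 <= `|u| / 4 <= 1.
    rewrite divr_ge0//= ler_pdivrMr// mul1r (le_trans upi)//.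
    by have := @pihalf_lt2 R; lra.
  have := H _ hu.
  have -> : `|u| / 4 *+ 2 = `|u| / 2 by rewrite -mulr_natr; field.
  move=> h1; rewrite -cos_norm one_sub_cos.
  have h2 : (`|u| / 4 / 2) ^+ 2 <= sin (`|u| / 2) ^+ 2.
    by rewrite lerXn2r// ?nnegrE ?divr_ge0// (le_trans _ h1)// !divr_ge0.
  move: h2; have -> : (`|u| / 4 / 2) ^+ 2 = u ^+ 2 / 64.
    by rewrite !exprMn real_normK ?num_real//; field.
  by lra.
move=> /andP[h0 h1]; rewrite sin_mulr2n.
have hh : h ^+ 2 <= 1 by rewrite -(expr1n _ 2) lerXn2r ?nnegrE.
have c1 : 1 / 2 <= cos h by have := one_sub_cos_le h; lra.
have s1 : h / 2 <= sin h.
  have := sin_taylor3 h; rewrite (ger0_norm h0) ler_norml => /andP[+ _].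
  have : h ^+ 3 <= h by rewrite exprSr -[leRHS]mul1r ler_wpM2r.
  by lra.
have : (1 / 2) * (h / 2) <= cos h * sin h by rewrite ler_pM// divr_ge0.
by rewrite -mulr_natr; lra.
Qed.

End taylor_bounds.

Section complex_exponential.
Context {R : realType}.
Implicit Types a b c : R.
Local Open Scope complex_scope.
Local Notation normc := Normc.normc.

(** Euler's formula for [exp (a + i b)]. *)
Definition cexp a b : R[i] := (expR a * cos b) +i* (expR a * sin b).

Lemma cexpD a b a' b' : cexp (a + a') (b + b') = cexp a b * cexp a' b'.
Proof.
by rewrite /cexp expRD cosD sinD; apply/eqP; rewrite eq_complex/=;
  apply/andP; split; apply/eqP; ring.
Qed.

Lemma cexp_sum (I : Type) (r : seq I) (f g : I -> R) :
  cexp (\sum_(i <- r) f i) (\sum_(i <- r) g i) =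
  \prod_(i <- r) cexp (f i) (g i).
Proof.
elim: r => [|i r IH]; last by rewrite !big_cons cexpD IH.
by rewrite !big_nil /cexp expR0 cos0 sin0 !mul1r.
Qed.

Lemma normc_cexp a b : normc (cexp a b) = expR a.
Proof.
rewrite /= !exprMn -mulrDr cos2Dsin2 mulr1 sqrtr_sqr ger0_norm//.
Qed.

Lemma normc_add (z w : R[i]) : normc (z + w) <= normc z + normc w.
Proof. exact: le_normcD. Qed.

Lemma normc_le_add a b : normc (a +i* b) <= `|a| + `|b|.
Proof.
rewrite /= -[leRHS]ger0_norm ?addr_ge0// -sqrtr_sqr ler_wsqrtr//.
rewrite sqrrD -[a ^+ 2]real_normK ?num_real// -[b ^+ 2]real_normK ?num_real//.
by rewrite lerD2r lerDl mulrn_wge0 ?mulr_ge0.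
Qed.

Lemma norm_Re_le (z : R[i]) : `|complex.Re z| <= normc z.
Proof.
by case: z => a b /=; rewrite -sqrtr_sqr ler_wsqrtr// lerDl sqr_ge0.
Qed.

Lemma normc_real a : normc a%:C = `|a|.
Proof. by rewrite /= expr0n addr0 sqrtr_sqr. Qed.

(** The second-order expansion at [w = a + i b], with [1 + w + w^2 / 2] written
    out in real and imaginary parts.  The growth factor depends only on the
    real part of [w]: this is what lets an exponential moment of a law bound the
    remainder for all frequencies at once. *)
Lemma cexp_taylor3 a b :
  normc (cexp a b -
     ((1 + a + (a ^+ 2 - b ^+ 2) / 2) +i* (b + a * b)))
  <= 2 * (`|a| + `|b|) ^+ 3 * expR `|a|.
Proof.
set E := expR `|a|.
have E1 : 1 <= E by rewrite -expR0 ler_expR.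
have aE : expR a <= E by rewrite ler_expR ler_norm.
rewrite /cexp /=; apply: le_trans (normc_le_add _ _) _.
have bb : `|b ^+ 2| = `|b| ^+ 2 by rewrite normrX.
have -> : expR a * cos b - (1 + a + (a ^+ 2 - b ^+ 2) / 2) =
   (expR a - 1 - a - a ^+ 2 / 2) + expR a * (cos b - 1 + b ^+ 2 / 2)
   - b ^+ 2 * (expR a - 1) / 2 by field.
have -> : expR a * sin b - (b + a * b) =
   expR a * (sin b - b) + b * (expR a - 1 - a) by ring.
have h1 := expR_taylor3 a.
have h2 : `|expR a * (cos b - 1 + b ^+ 2 / 2)| <= E * `|b| ^+ 3.
  by rewrite normrM (ger0_norm (expR_ge0 _)) ler_pM ?expR_ge0// cos_taylor3.
have h3 : `|b ^+ 2 * (expR a - 1) / 2| <= `|b| ^+ 2 * (`|a| * E).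
  rewrite normrM normrM bb.
  have : `|b| ^+ 2 * `|expR a - 1| <= `|b| ^+ 2 * (`|a| * E).
    by rewrite ler_wpM2l ?expr_ge0// expR_taylor1.
  have : 0 <= `|b| ^+ 2 * `|expR a - 1| by rewrite mulr_ge0 ?expr_ge0.
  have -> : `|2^-1 : R| = 2^-1 by rewrite ger0_norm.
  by lra.
have h4 : `|expR a * (sin b - b)| <= E * `|b| ^+ 3.
  rewrite normrM (ger0_norm (expR_ge0 _)) ler_pM ?expR_ge0//.
  rewrite (le_trans (sin_taylor3 _))//.
  have : 0 <= `|b| ^+ 3 by rewrite exprn_ge0.
  by lra.
have h5 : `|b * (expR a - 1 - a)| <= `|b| * (`|a| ^+ 2 * E).
  by rewrite normrM ler_wpM2l ?expR_taylor2.
apply: (@le_trans _ _ (E * (`|a| ^+ 3 + 2 * `|b| ^+ 3 + `|b| ^+ 2 * `|a|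
    + `|b| * `|a| ^+ 2))).
  have t1 := ler_normB (expR a - 1 - a - a ^+ 2 / 2 +
    expR a * (cos b - 1 + b ^+ 2 / 2)) (b ^+ 2 * (expR a - 1) / 2).
  have t2 := ler_normD (expR a - 1 - a - a ^+ 2 / 2)
    (expR a * (cos b - 1 + b ^+ 2 / 2)).
  have t3 := ler_normD (expR a * (sin b - b)) (b * (expR a - 1 - a)).
  move: h1 h2 h3 h4 h5 t1 t2 t3; rewrite -/E.
  by lra.
rewrite mulrC ler_wpM2r//; first by rewrite (le_trans _ E1).
have a0 := normr_ge0 a; have b0 := normr_ge0 b.
have p3 : 0 <= `|a| ^+ 3 by rewrite exprn_ge0.
have p4 : 0 <= `|b| ^+ 2 * `|a| by rewrite mulr_ge0 ?exprn_ge0.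
have p5 : 0 <= `|b| * `|a| ^+ 2 by rewrite mulr_ge0 ?exprn_ge0.
have -> : (`|a| + `|b|) ^+ 3 = `|a| ^+ 3 + 3 * (`|b| * `|a| ^+ 2)
   + 3 * (`|b| ^+ 2 * `|a|) + `|b| ^+ 3 by ring.
lra.
Qed.

(** The difference telescopes into [n] terms, each with one factor [f i - g i]
    and [n - 1] factors of size at most [rho]. *)
Lemma normc_prod_sub (n : nat) (f g : 'I_n -> R[i]) (eta rho : R) :
  (forall i, normc (f i) <= rho) ->
  (forall i, normc (g i) <= rho) ->
  (forall i, normc (f i - g i) <= eta) ->
  normc (\prod_i f i - \prod_i g i) <= n%:R * eta * rho ^+ n.-1.
Proof.
have n0 (z : R[i]) : 0 <= normc z.
  by case: z => x y /=; rewrite sqrtr_ge0.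
elim: n f g => [|n IH] f g frho grho fg.
  by rewrite !big_ord0 subrr mul0r mul0r Normc.normc0.
rewrite !big_ord_recl.
have -> : f ord0 * \prod_(i < n) f (lift ord0 i)
    - g ord0 * \prod_(i < n) g (lift ord0 i) =
    (f ord0 - g ord0) * \prod_(i < n) f (lift ord0 i) +
    g ord0 * (\prod_(i < n) f (lift ord0 i) - \prod_(i < n) g (lift ord0 i)).
  by ring.
apply: (le_trans (normc_add _ _)); rewrite !Normc.normcM.
have rho0 : 0 <= rho by rewrite (le_trans _ (frho ord0)).
have eta0 : 0 <= eta by rewrite (le_trans _ (fg ord0)).
have h1 : normc (\prod_(i < n) f (lift ord0 i)) <= rho ^+ n.
  rewrite (big_morph _ (@Normc.normcM _) (@Normc.normc1 _)).
  rewrite -[X in _ ^+ X]card_ord -prodr_const.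
  by apply: ler_prod => i _; rewrite n0 frho.
have h2 := ler_pM (n0 _) (n0 _) (fg ord0) h1.
have h3 := ler_pM (n0 _) (n0 _) (grho ord0)
  (IH _ _ (fun i => frho (lift ord0 i)) (fun i => grho (lift ord0 i))
    (fun i => fg (lift ord0 i))).
refine (le_trans (lerD h2 h3) _) => /=.
clear -n; case: n => [|n] /=.
  by rewrite !mul0r mulr0 addr0 mul1r.
by rewrite -[n.+2%:R]natr1 exprS le_eqVlt; apply/orP; left; apply/eqP; ring.
Qed.

End complex_exponential.

(** * One step: the transform of a centred law on a finite set *)

Section single_step.
Context {R : realType} {I : finType}.
Variables (p Y : I -> R).
Hypothesis p_ge0 : forall u, 0 <= p u.
Local Open Scope complex_scope.
Local Notation normc := Normc.normc.

(** [E exp ((t + i th) Y)], for [Y u] of mass [p u]; [p] need not have total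
    mass one, so that truncated laws are covered. *)
Definition laplace (t th : R) : R[i] :=
  \sum_u (p u)%:C * cexp (t * Y u) (th * Y u).

Lemma Re_laplace t th :
  complex.Re (laplace t th) = \sum_u p u * (expR (t * Y u) * cos (th * Y u)).
Proof.
rewrite /laplace; elim/big_rec2 : _ => [//|u x z _ <-].
by case: z => z1 z2; rewrite /cexp /= mul0r subr0.
Qed.

Lemma Im_laplace t th :
  complex.Im (laplace t th) = \sum_u p u * (expR (t * Y u) * sin (th * Y u)).
Proof.
rewrite /laplace; elim/big_rec2 : _ => [//|u x z _ <-].
by case: z => z1 z2; rewrite /cexp /= mul0r addr0.
Qed.

Definition tilt_mass (t : R) : R := \sum_u p u * expR (t * Y u).

(** [E (1 - cos (th (Y - Y')))] for independent copies [Y], [Y'] under the law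
    tilted by [exp (t Y)], up to normalisation: it vanishes when
    the law lives on a coset on which [exp (i th Y)] is constant. *)
Definition tilt_spread (t th : R) : R :=
  \sum_u \sum_v p u * p v * expR (t * Y u) * expR (t * Y v)
    * (1 - cos (th * (Y u - Y v))).

Lemma laplace0 t : laplace t 0 = (tilt_mass t)%:C.
Proof.
apply/eqP; rewrite eq_complex Re_laplace Im_laplace /=; apply/andP; split.
  by apply/eqP/eq_bigr => u _; rewrite mul0r cos0 mulr1.
by rewrite big1// => u _; rewrite mul0r sin0 !mulr0.
Qed.

Lemma tilt_mass_ge0 t : 0 <= tilt_mass t.
Proof. by apply: sumr_ge0 => u _; rewrite mulr_ge0 ?expR_ge0. Qed.

(** [|E exp (i th Y)|^2] is [E cos (th (Y - Y'))]. *)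
Lemma normc_laplace_sqr t th :
  normc (laplace t th) ^+ 2 = tilt_mass t ^+ 2 - tilt_spread t th.
Proof.
have -> : normc (laplace t th) ^+ 2 =
    complex.Re (laplace t th) ^+ 2 + complex.Im (laplace t th) ^+ 2.
  by case: (laplace t th) => a b /=; rewrite sqr_sqrtr// addr_ge0 ?sqr_ge0.
rewrite Re_laplace Im_laplace /tilt_mass !expr2 !big_distrlr/= /tilt_spread.
rewrite -big_split/= -sumrB; apply: eq_bigr => u _.
rewrite -big_split/= -sumrB; apply: eq_bigr => v _.
by rewrite (mulrBr th) cosB; ring.
Qed.

(** [exp w] against [1 + w] at [w = s (t + i th)^2 / 2].  The error is of order
    four in [(t, th)]; one order is given up, at the price of the bound [W],
    because the transform of a law is only known to order three. *)
Lemma cexp_near_quadratic (s t th S W : R) :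
  0 <= s <= S -> `|t| + `|th| <= W ->
  normc (cexp (s * (t ^+ 2 - th ^+ 2) / 2) (s * (t * th)) -
    ((1 + s * (t ^+ 2 - th ^+ 2) / 2) +i* (s * (t * th))))
  <= (S ^+ 2 * W + 2 * S ^+ 3 * W ^+ 3 * expR (S * W ^+ 2))
     * (`|t| + `|th|) ^+ 3.
Proof.
move=> /andP[s0 sS] wW.
set a := s * (t ^+ 2 - th ^+ 2) / 2; set b := s * (t * th).
set w := `|t| + `|th|.
have w0 : 0 <= w by rewrite addr_ge0.
have S0 : 0 <= S by rewrite (le_trans s0).
have W0 : 0 <= W by rewrite (le_trans w0).
have abq : `|a| + `|b| <= S * w ^+ 2.
  have -> : `|a| = s * `|t ^+ 2 - th ^+ 2| / 2.
    by rewrite !normrM (ger0_norm s0) (ger0_norm (_ : 0 <= 2^-1)).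
  have -> : `|b| = s * (`|t| * `|th|) by rewrite !normrM (ger0_norm s0).
  have tt : `|t ^+ 2 - th ^+ 2| <= `|t| ^+ 2 + `|th| ^+ 2.
    by rewrite -!normrX ler_normB.
  have tt0 : 0 <= `|t| ^+ 2 + `|th| ^+ 2 by rewrite addr_ge0 ?exprn_ge0.
  have tp0 : 0 <= `|t| * `|th| by rewrite mulr_ge0.
  apply: (@le_trans _ _ (s * w ^+ 2)); last by rewrite ler_wpM2r ?exprn_ge0.
  rewrite -mulrA -mulrDr ler_wpM2l//.
  have -> : w ^+ 2 = `|t| ^+ 2 + `|th| ^+ 2 + 2 * (`|t| * `|th|).
    by rewrite /w; ring.
  by lra.
have a0 := normr_ge0 a; have b0 := normr_ge0 b.
have q0 : 0 <= S * w ^+ 2 by rewrite mulr_ge0 ?exprn_ge0.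
have -> : cexp a b - ((1 + a) +i* b) =
   (cexp a b - ((1 + a + (a ^+ 2 - b ^+ 2) / 2) +i* (b + a * b))) +
   (((a ^+ 2 - b ^+ 2) / 2) +i* (a * b)).
  rewrite /cexp; apply/eqP; rewrite eq_complex/=.
  by apply/andP; split; apply/eqP; ring.
apply: (le_trans (normc_add _ _)).
have h1 : normc (((a ^+ 2 - b ^+ 2) / 2) +i* (a * b)) <=
    (S * w ^+ 2) ^+ 2 / 2.
  apply: (le_trans (normc_le_add _ _)).
  apply: (@le_trans _ _ ((`|a| + `|b|) ^+ 2 / 2)); last first.
    by rewrite ler_wpM2r// lerXn2r// nnegrE addr_ge0.
  have : `|(a ^+ 2 - b ^+ 2) / 2| <= (`|a| ^+ 2 + `|b| ^+ 2) / 2.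
    rewrite normrM (ger0_norm (_ : 0 <= 2^-1))// ler_wpM2r//.
    by rewrite -!normrX ler_normB.
  rewrite (normrM a b).
  have -> : (`|a| + `|b|) ^+ 2 = `|a| ^+ 2 + `|b| ^+ 2 + 2 * (`|a| * `|b|).
    by ring.
  by lra.
have h2 : 2 * (`|a| + `|b|) ^+ 3 * expR `|a| <=
    2 * (S * w ^+ 2) ^+ 3 * expR (S * W ^+ 2).
  rewrite ler_pM ?expR_ge0 ?mulr_ge0 ?exprn_ge0 ?addr_ge0//.
    by rewrite ler_wpM2l// lerXn2r// nnegrE addr_ge0.
  rewrite ler_expR (@le_trans _ _ (S * w ^+ 2))//; first by lra.
  by rewrite ler_wpM2l// lerXn2r// nnegrE.
have w1 : (S * w ^+ 2) ^+ 2 <= S ^+ 2 * W * w ^+ 3.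
  have -> : (S * w ^+ 2) ^+ 2 = S ^+ 2 * w * w ^+ 3 by ring.
  by rewrite ler_wpM2r ?exprn_ge0// ler_wpM2l ?exprn_ge0.
have w2 : (S * w ^+ 2) ^+ 3 <= S ^+ 3 * W ^+ 3 * w ^+ 3.
  have -> : (S * w ^+ 2) ^+ 3 = S ^+ 3 * w ^+ 3 * w ^+ 3 by ring.
  by rewrite ler_wpM2r ?exprn_ge0// ler_wpM2l ?exprn_ge0// lerXn2r// nnegrE.
have h3 := cexp_taylor3 a b.
have w4 : (S * w ^+ 2) ^+ 3 * expR (S * W ^+ 2) <=
    S ^+ 3 * W ^+ 3 * w ^+ 3 * expR (S * W ^+ 2) by rewrite ler_wpM2r ?expR_ge0.
have w5 : 0 <= (S * w ^+ 2) ^+ 2 by rewrite exprn_ge0.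
rewrite -/w [leRHS](_ : _ = S ^+ 2 * W * w ^+ 3 +
  2 * (S ^+ 3 * W ^+ 3 * w ^+ 3 * expR (S * W ^+ 2))); last by ring.
move: h1 h2 h3 w1 w4 w5; lra.
Qed.

Variables (s e M tau : R).
Hypothesis mass1 : `|\sum_u p u - 1| <= e.
Hypothesis mean0 : `|\sum_u p u * Y u| <= e.
Hypothesis var_s : `|\sum_u p u * Y u ^+ 2 - s| <= e.
Hypothesis third : \sum_u p u * (`|Y u| ^+ 3 * expR (tau * `|Y u|)) <= M.

(** Expand the exponential under the sum: the polynomial part involves moments
    of order at most two, which are almost [1], [0] and [s]. *)
Lemma laplace_near_quadratic t th : `|t| <= tau ->
  normc (laplace t th -
    ((1 + s * (t ^+ 2 - th ^+ 2) / 2) +i* (s * (t * th))))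
  <= 2 * M * (`|t| + `|th|) ^+ 3 + e * (1 + (`|t| + `|th|)) ^+ 2.
Proof.
move=> tt.
have e0 : 0 <= e by rewrite (le_trans _ mass1).
set w := `|t| + `|th|; have w0 : 0 <= w by rewrite addr_ge0.
pose P2 u : R[i] := (1 + t * Y u + ((t * Y u) ^+ 2 - (th * Y u) ^+ 2) / 2) +i*
  (th * Y u + (t * Y u) * (th * Y u)).
have -> : laplace t th -
    ((1 + s * (t ^+ 2 - th ^+ 2) / 2) +i* (s * (t * th))) =
  \sum_u (p u)%:C * (cexp (t * Y u) (th * Y u) - P2 u) +
  (\sum_u (p u)%:C * P2 u -
    ((1 + s * (t ^+ 2 - th ^+ 2) / 2) +i* (s * (t * th)))).
  rewrite addrA -big_split/=; congr (_ - _); apply: eq_bigr => u _.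
  by rewrite -mulrDr subrK.
apply: (le_trans (normc_add _ _)); apply: lerD.
  have nsum (F : I -> R[i]) : normc (\sum_u F u) <= \sum_u normc (F u).
    elim/big_rec2 : _ => [|u x z _ H]; first by rewrite Normc.normc0.
    by rewrite (le_trans (normc_add _ _))// lerD2l.
  apply: (le_trans (nsum _)).
  apply: (@le_trans _ _ (\sum_u p u * (2 * w ^+ 3 *
     (`|Y u| ^+ 3 * expR (tau * `|Y u|))))).
    apply: ler_sum => u _; rewrite Normc.normcM normc_real (ger0_norm (p_ge0 u)).
    rewrite ler_wpM2l//; apply: (le_trans (cexp_taylor3 _ _)).
    rewrite !normrM -mulrDl exprMn -/w -!mulrA.
    rewrite !ler_wpM2l ?exprn_ge0//.
    by rewrite ler_expR ler_wpM2r.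
  rewrite [leRHS](_ : _ = 2 * w ^+ 3 * M); last by ring.
  under eq_bigr do rewrite mulrCA.
  by rewrite -mulr_sumr ler_wpM2l// mulr_ge0 ?exprn_ge0.
have -> : \sum_u (p u)%:C * P2 u = (\sum_u p u + t * (\sum_u p u * Y u)
    + (t ^+ 2 - th ^+ 2) / 2 * (\sum_u p u * Y u ^+ 2)) +i*
   (th * (\sum_u p u * Y u) + t * th * (\sum_u p u * Y u ^+ 2)).
  rewrite !mulr_sumr -!big_split/=.
  elim/big_rec3 : _ => [//|u a b z _ ->]; rewrite /P2.
  apply/eqP; rewrite eq_complex/=; apply/andP.
  by split; apply/eqP; field.
set m0 := \sum_u p u; set m1 := \sum_u p u * Y u.
set m2 := \sum_u p u * Y u ^+ 2.
rewrite [X in normc X](_ : _ =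
  ((m0 - 1) + t * m1 + (t ^+ 2 - th ^+ 2) / 2 * (m2 - s)) +i*
  (th * m1 + t * th * (m2 - s))); last first.
  by apply/eqP; rewrite eq_complex/=; apply/andP; split; apply/eqP; field.
apply: (le_trans (normc_le_add _ _)).
have k1 : `|m0 - 1 + t * m1 + (t ^+ 2 - th ^+ 2) / 2 * (m2 - s)| <=
    e + `|t| * e + (`|t| ^+ 2 + `|th| ^+ 2) / 2 * e.
  apply: (le_trans (ler_normD _ _)); apply: lerD.
    apply: (le_trans (ler_normD _ _)); apply: lerD => //.
    by rewrite normrM ler_wpM2l.
  rewrite normrM ler_pM// normrM (ger0_norm (_ : 0 <= 2^-1))// ler_wpM2r//.
  by rewrite -!normrX ler_normB.
have k2 : `|th * m1 + t * th * (m2 - s)| <= `|th| * e + `|t| * `|th| * e.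
  apply: (le_trans (ler_normD _ _)); rewrite !normrM.
  by apply: lerD; rewrite ler_wpM2l// mulr_ge0.
apply: (le_trans (lerD k1 k2)).
rewrite -subr_ge0 /w.
rewrite (_ : _ - _ = e * ((`|t| + `|th|) + (`|t| + `|th|) ^+ 2 / 2)).
  by rewrite mulr_ge0// addr_ge0 ?addr_ge0// mulr_ge0 ?exprn_ge0 ?addr_ge0.
by field.
Qed.

Lemma laplace_near_gaussian (S W t th : R) :
  0 <= s <= S -> `|t| + `|th| <= W -> `|t| <= tau ->
  normc (laplace t th -
    cexp (s * (t ^+ 2 - th ^+ 2) / 2) (s * (t * th)))
  <= (2 * M + (S ^+ 2 * W + 2 * S ^+ 3 * W ^+ 3 * expR (S * W ^+ 2)))
       * (`|t| + `|th|) ^+ 3 + e * (1 + W) ^+ 2.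
Proof.
move=> sS wW tt.
have h1 := laplace_near_quadratic th tt.
have h2 := cexp_near_quadratic sS wW.
set q := (1 + _) +i* _ in h1 h2.
rewrite -[X in normc X](subrKA q) -[q - _]opprB.
apply: (le_trans (normc_add _ _)).
rewrite normcN.
have e0 : 0 <= e by rewrite (le_trans _ mass1).
have : e * (1 + (`|t| + `|th|)) ^+ 2 <= e * (1 + W) ^+ 2.
  have w0 : 0 <= `|t| + `|th| by rewrite addr_ge0.
  rewrite ler_wpM2l// lerXn2r ?nnegrE ?addr_ge0 ?lerD2l//.
  by rewrite (le_trans _ wW).
move: h1 h2; lra.
Qed.

(** The expansion at the real point [t], put into an exponent so that bounds
    for [n] steps multiply. *)
Lemma tilt_mass_le t : `|t| <= tau ->
  tilt_mass t <=
    expR (s * t ^+ 2 / 2 + 2 * M * `|t| ^+ 3 + e * (1 + `|t|) ^+ 2).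
Proof.
move=> tt; apply: le_trans (expR_ge1Dx _).
have := laplace_near_quadratic 0 tt.
move/(le_trans (norm_Re_le _)).
rewrite laplace0 /= normr0 expr0n/= subr0 addr0 => /(le_trans (ler_norm _)).
by lra.
Qed.

(** By [normc_laplace_sqr] a spread of order [th^2] is a relative loss of order
    [th^2] in the square of the modulus, and [1 - x <= exp (- x)]. *)
Lemma normc_laplace_le (kappa K t th : R) : `|t| <= tau ->
  0 <= kappa -> 0 < K ->
  expR (s * t ^+ 2 / 2 + 2 * M * `|t| ^+ 3 + e * (1 + `|t|) ^+ 2) ^+ 2 <= K ->
  kappa * th ^+ 2 <= tilt_spread t th ->
  normc (laplace t th) <=
    expR (s * t ^+ 2 / 2 + 2 * M * `|t| ^+ 3 + e * (1 + `|t|) ^+ 2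
      - kappa / (2 * K) * th ^+ 2).
Proof.
move=> tt k0 K0 EK hk.
set E := _ + e * _ in EK *.
have m0 := tilt_mass_ge0 t; have mE := tilt_mass_le tt; rewrite -/E in mE.
rewrite -[leRHS]ger0_norm ?expR_ge0// -sqrtr_sqr -[leLHS]ger0_norm; last first.
  by case: (laplace t th) => a b /=; rewrite sqrtr_ge0.
rewrite -sqrtr_sqr ler_wsqrtr// normc_laplace_sqr.
have E0 : 0 < expR E ^+ 2 by rewrite exprn_gt0 ?expR_gt0.
have -> : expR (E - kappa / (2 * K) * th ^+ 2) ^+ 2 =
    expR E ^+ 2 * expR (- (kappa / K * th ^+ 2)).
  rewrite -!expRM_natl -expRD; congr expR.
  by field; rewrite gt_eqF.
apply: (@le_trans _ _ (expR E ^+ 2 - kappa * th ^+ 2)).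
  by rewrite lerB// lerXn2r ?nnegrE ?expR_ge0.
apply: (@le_trans _ _ (expR E ^+ 2 * (1 - kappa / K * th ^+ 2))); last first.
  by rewrite ler_wpM2l ?expR_ge1Dx// ltW.
rewrite mulrBr mulr1 lerB//.
rewrite [leLHS](_ : _ = expR E ^+ 2 / K * (kappa * th ^+ 2)); last first.
  by field; rewrite gt_eqF.
rewrite -[leRHS]mul1r ler_wpM2r ?(mulr_ge0 k0 (sqr_ge0 _))//.
by rewrite ler_pdivrMr// mul1r.
Qed.

End single_step.

(** * Comparison with a Gaussian integral, and Fourier inversion *)

Section gaussian_comparison.
Context {R : realType}.
Local Notation mu := (@lebesgue_measure R).

Lemma gaussian_eq_normal_pdf (s x : R) : 0 < s ->
  expR (- (s * x ^+ 2)) =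
    Num.sqrt (pi / s) * normal_pdf 0 (Num.sqrt ((2 * s)^-1)) x.
Proof.
move=> s0; set sg := Num.sqrt ((2 * s)^-1).
have sg2 : sg ^+ 2 = (2 * s)^-1 by rewrite sqr_sqrtr// ltW// invr_gt0 mulr_gt0.
have sg0 : sg != 0.
  by rewrite gt_eqF// sqrtr_gt0 invr_gt0 mulr_gt0.
rewrite (normal_pdfE _ sg0) /normal_peak /normal_fun sg2 subr0.
have -> : (2 * s)^-1 *+ 2 = s^-1 by rewrite -mulr_natr; field; rewrite gt_eqF.
have -> : (2 * s)^-1 * pi *+ 2 = pi / s.
  by rewrite -mulr_natr; field; rewrite gt_eqF.
rewrite [RHS]mulrA divff ?mul1r; last by rewrite gt_eqF// sqrtr_gt0 divr_gt0 ?pi_gt0.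
by rewrite invrK mulNr mulrC.
Qed.

Lemma integrable_gaussian (s : R) : 0 < s ->
  mu.-integrable [set: R] (EFin \o (fun x => expR (- (s * x ^+ 2)))).
Proof.
move=> s0; rewrite [X in integrable _ _ X](_ : _ = (fun x =>
    (Num.sqrt (pi / s))%:E * (normal_pdf 0 (Num.sqrt ((2 * s)^-1)) x)%:E)%E).
  by apply: integrableZl => //; exact: integrable_normal_pdf.
by apply/funext => x /=; rewrite (gaussian_eq_normal_pdf _ s0) EFinM.
Qed.

Lemma Rintegral_gaussian (s : R) : 0 < s ->
  \int[mu]_x expR (- (s * x ^+ 2)) = Num.sqrt (pi / s).
Proof.
move=> s0; under eq_Rintegral do rewrite (gaussian_eq_normal_pdf _ s0).
rewrite RintegralZl//; last exact: integrable_normal_pdf.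
by rewrite /Rintegral integral_normal_pdf/= mulr1.
Qed.

(** Extending [h] by zero outside of the interval leaves an integrable function
    on the line, dominated there by one Gaussian; so only the full Gaussian
    integral is ever computed. *)
Lemma Rintegral_near_gaussian (h : R -> R) (a B s D : R) :
  {within `[- a, a], continuous h} -> 0 < B -> 0 < s ->
  (forall x, `|x| <= a ->
     `|h x - expR (- (B * x ^+ 2))| <= D * expR (- (s * x ^+ 2))) ->
  (forall x, a < `|x| ->
     expR (- (B * x ^+ 2)) <= D * expR (- (s * x ^+ 2))) ->
  `|\int[mu]_(x in `[- a, a]) h x - Num.sqrt (pi / B)| <= D * Num.sqrt (pi / s).
Proof.
move=> ch B0 s0 hin hout.
have ih : mu.-integrable [set: R] (EFin \o (h \_ `[- a, a])).
  rewrite -restrict_EFin; apply/integrable_restrict => //=.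
  rewrite setTI; apply: continuous_compact_integrable => //.
  exact: segment_compact.
have iB := integrable_gaussian B0; have iS := integrable_gaussian s0.
rewrite Rintegral_mkcond -(Rintegral_gaussian B0) -RintegralB//.
rewrite -(Rintegral_gaussian s0) -RintegralZl//.
have id : mu.-integrable [set: R]
    (EFin \o (fun x => (h \_ `[- a, a]) x - expR (- (B * x ^+ 2)))).
  exact: (integrableB measurableT ih iB).
apply: (le_trans (le_normr_Rintegral _ id)) => //.
apply: le_Rintegral => //.
- exact: integrable_norm.
- exact: (integrableZl measurableT D iS).
move=> x _; rewrite patchE; case: ifPn => [|].
  by rewrite inE/= in_itv/= -ler_norml => /hin.
rewrite notin_setE/= in_itv/= -ler_norml => /negP; rewrite -ltNge => /hout.
by rewrite sub0r normrN ger0_norm// expR_ge0.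
Qed.

End gaussian_comparison.

Section fourier_inversion.
Context {R : realType}.
Local Notation mu := (@lebesgue_measure R).

Lemma sin_intr_pi (l : int) : sin (l%:~R * pi : R) = 0.
Proof.
have sn (n : nat) : sin (n%:R * pi : R) = 0.
  elim: n => [|n IH]; first by rewrite mul0r sin0.
  by rewrite -natr1 mulrDl mul1r sinDpi IH oppr0.
case: l => n; first exact: sn.
by rewrite NegzE mulrNz mulNr sinN sn oppr0.
Qed.

Lemma continuous_cos_freq (c : R) : continuous (fun x : R => cos (c * x)).
Proof.
move=> x; apply: (@continuous_comp _ _ _ (fun x => c * x) cos).
  exact: mulrl_continuous.
exact: continuous_cos.
Qed.

Lemma Rintegral_cos_freq (l : int) :
  \int[mu]_(x in `[- pi, pi]) cos (l%:~R * x) = 2 * pi * (l == 0)%:R.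
Proof.
have pi0 := @pi_gt0 R; have lt_pi : - pi < pi :> R by lra.
have [->|l0] := eqVneq l 0.
  under eq_Rintegral do rewrite mul0r cos0.
  have : mu `[- pi, pi] = (pi - - pi)%:E.
    by rewrite lebesgue_measure_itv/= lte_fin lt_pi EFinB.
  move=> m; rewrite Rintegral_cst//; transitivity (1 * (pi - - pi) : R).
    by congr (_ * _); exact: (congr1 fine m).
  by rewrite mulr1; ring.
have lr0 : l%:~R != 0 :> R by rewrite intr_eq0.
have d (x : R) : is_derive x 1 (fun y : R => sin (l%:~R * y) / l%:~R) (cos (l%:~R * x)).
  apply: is_derive_eq.
  by rewrite /GRing.scale/= !(mulr0, mulr1, add0r, addr0); field.
rewrite mulr0 /Rintegral (@continuous_FTC2 _ (fun x => cos (l%:~R * x))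
  (fun x => sin (l%:~R * x) / l%:~R))//.
- by rewrite /= mulrN sinN sin_intr_pi oppr0 subrr.
- exact/continuous_subspaceT/continuous_cos_freq.
- have cF : continuous (fun y : R => sin (l%:~R * y) / l%:~R).
    move=> x; apply: differentiable_continuous; apply/derivable1_diffP.
    exact: (@ex_derive _ _ _ _ _ _ _ (d x)).
  split.
  + by move=> x _; exact: (@ex_derive _ _ _ _ _ _ _ (d x)).
  + exact/cvg_at_right_filter/cF.
  + exact/cvg_at_left_filter/cF.
- move=> x _; rewrite derive1E; exact: (@derive_val _ _ _ _ _ _ _ (d x)).
Qed.

Lemma integrable_cos_freq (c : R) (a b : R) :
  mu.-integrable `[a, b] (EFin \o (fun x => cos (c * x))).
Proof.
apply: continuous_compact_integrable; first exact: segment_compact.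
exact/continuous_subspaceT/continuous_cos_freq.
Qed.

(** Orthogonality of the characters of the circle: integrating over one period
    retains the paths with [l i = 0]. *)
Lemma Rintegral_trig_poly (I : finType) (w : I -> R) (l : I -> int) :
  \int[mu]_(x in `[- pi, pi]) (\sum_i w i * cos ((l i)%:~R * x)) =
  2 * pi * \sum_(i | l i == 0) w i.
Proof.
rewrite /Rintegral; under eq_integral do rewrite -sumEFin.
have ii i : mu.-integrable `[- pi, pi]
    (fun x => (w i * cos ((l i)%:~R * x))%:E).
  exact: (integrableZl _ (w i) (integrable_cos_freq (l i)%:~R _ _)).
rewrite (integral_sum _ ii)// -sum_fine; last first.
  by move=> i _; exact: integrable_fin_num.
rewrite [in RHS]big_mkcond mulr_sumr; apply: eq_bigr => i _.
rewrite -/(Rintegral _ _ _) RintegralZl//; last exact: integrable_cos_freq.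
by rewrite Rintegral_cos_freq; case: (l i == 0) => /=; ring.
Qed.

Lemma continuous_trig_poly (I : finType) (w c : I -> R) :
  continuous (fun x : R => \sum_i w i * cos (c i * x)).
Proof.
elim: (index_enum I) => [|i s IH].
  by under eq_fun do rewrite big_nil; exact: cst_continuous.
under eq_fun do rewrite big_cons.
move=> x; apply: cvgD; last exact: IH.
by apply: cvgM; [exact: cvg_cst|exact: continuous_cos_freq].
Qed.

End fourier_inversion.

(** * Local limit theorem for steps of finite range *)

Section finite_local_limit.
Context {R : realType}.
Local Open Scope complex_scope.
Local Notation normc := Normc.normc.

(** Uniform control of one truncated, centred step: [s] is the variance before
    truncation and [e] the error that truncation makes on the moments. *)
Record regular_step (I : finType) (p Y : I -> R) (s e tau S M kappa v : R) :
    Prop := RegularStep {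
  step_ge0 : forall u, 0 <= p u;
  step_mass : `|\sum_u p u - 1| <= e;
  step_mean : `|\sum_u p u * Y u| <= e;
  step_var : `|\sum_u p u * Y u ^+ 2 - s| <= e;
  step_third : \sum_u p u * (`|Y u| ^+ 3 * expR (tau * `|Y u|)) <= M;
  step_var_bounds : v <= s <= S;
  step_spread : forall t th, `|t| <= tau -> `|th| <= pi ->
    kappa * th ^+ 2 <= tilt_spread p Y t th }.

(** The constants in front of [(|t| + |th|)^3] and in front of [- th^2] for one
    step, independent of the step. *)
Definition cube_const (S M W : R) : R :=
  2 * M + (S ^+ 2 * W + 2 * S ^+ 3 * W ^+ 3 * expR (S * W ^+ 2)).

Definition decay_const (tau S M kappa v : R) : R :=
  Num.min (v / 2) (kappa /
    (2 * expR (S * tau ^+ 2 / 2 + 2 * M * tau ^+ 3 + (1 + tau) ^+ 2) ^+ 2)).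

Lemma decay_const_gt0 (tau S M kappa v : R) :
  0 < kappa -> 0 < v -> 0 < decay_const tau S M kappa v.
Proof.
move=> k0 v0; rewrite lt_min divr_gt0//= divr_gt0// mulr_gt0// exprn_gt0//.
exact: expR_gt0.
Qed.

(** [exp (s (t + i th)^2 / 2)] divided by its value [exp (s t^2 / 2)] at
    [th = 0]. *)
Definition gauss_factor (s t th : R) : R[i] :=
  cexp (- (s * th ^+ 2 / 2)) (s * (t * th)).

(** The three bounds that telescoping needs.  The normalisation by
    [exp (- s t^2 / 2)] removes the only part of the size of a factor that is
    not negligible after [n] steps. *)
Lemma step_factors (I : finType) (p Y : I -> R) (s e tau S M kappa v t th : R) :
  regular_step p Y s e tau S M kappa v ->
  0 < kappa -> 0 < v -> e <= 1 -> `|t| <= tau -> `|th| <= pi ->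
  let f := (expR (- (s * t ^+ 2 / 2)))%:C * laplace p Y t th in
  let c := decay_const tau S M kappa v in
  let rho := expR (2 * M * `|t| ^+ 3 + e * (1 + `|t|) ^+ 2 - c * th ^+ 2) in
  [/\ normc f <= rho, normc (gauss_factor s t th) <= rho &
      normc (f - gauss_factor s t th) <=
        cube_const S M (tau + 4) * (`|t| + `|th|) ^+ 3 + e * (5 + tau) ^+ 2].
Proof.
move=> [p0 mass mean var third /andP[vs sS] spread] k0 v0 e1 tt thpi f c rho.
have tau0 : 0 <= tau by rewrite (le_trans _ tt).
have e0 : 0 <= e by rewrite (le_trans _ mass).
have s0 : 0 <= s by rewrite (le_trans (ltW v0)).
have S0 : 0 <= S by rewrite (le_trans s0).
have M0 : 0 <= M.
  rewrite (le_trans _ third)// sumr_ge0// => u _.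
  by rewrite mulr_ge0// mulr_ge0 ?exprn_ge0 ?expR_ge0.
have t3 : 0 <= M * `|t| ^+ 3 by rewrite mulr_ge0 ?exprn_ge0.
have et : 0 <= e * (1 + `|t|) ^+ 2 by rewrite mulr_ge0 ?exprn_ge0 ?addr_ge0.
have nT : normc (expR (- (s * t ^+ 2 / 2)))%:C = expR (- (s * t ^+ 2 / 2)).
  by rewrite normc_real ger0_norm ?expR_ge0.
split.
- set K := expR (S * tau ^+ 2 / 2 + 2 * M * tau ^+ 3 + (1 + tau) ^+ 2) ^+ 2.
  have K0 : 0 < K by rewrite exprn_gt0 ?expR_gt0.
  have EK : expR (s * t ^+ 2 / 2 + 2 * M * `|t| ^+ 3 + e * (1 + `|t|) ^+ 2) ^+ 2
      <= K.
    rewrite lerXn2r ?nnegrE ?expR_ge0// ler_expR lerD//.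
      rewrite lerD//.
        rewrite ler_wpM2r// ler_pM ?sqr_ge0//.
        by rewrite -real_normK ?num_real// lerXn2r.
      by rewrite ler_wpM2l ?mulr_ge0// lerXn2r.
    rewrite -[leRHS]mul1r ler_pM ?exprn_ge0 ?addr_ge0//.
    by rewrite lerXn2r ?nnegrE ?addr_ge0 ?lerD2l.
  have := normc_laplace_le p0 mass mean var third tt (ltW k0) K0 EK
    (spread _ _ tt thpi).
  rewrite /f Normc.normcM nT => /(ler_wpM2l (expR_ge0 (- (s * t ^+ 2 / 2)))).
  move/le_trans; apply; rewrite -expRD ler_expR.
  have cK : c * th ^+ 2 <= kappa / (2 * K) * th ^+ 2.
    by rewrite ler_wpM2r ?sqr_ge0// ge_min lexx orbT.
  by move: cK; lra.
- rewrite /gauss_factor normc_cexp ler_expR.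
  have cv : c * th ^+ 2 <= s / 2 * th ^+ 2.
    rewrite ler_wpM2r ?sqr_ge0// (@le_trans _ _ (v / 2)) ?ge_min ?lexx//.
    by rewrite ler_wpM2r.
  by move: cv t3 et; lra.
have -> : f - gauss_factor s t th = (expR (- (s * t ^+ 2 / 2)))%:C *
    (laplace p Y t th - cexp (s * (t ^+ 2 - th ^+ 2) / 2) (s * (t * th))).
  rewrite mulrBr; congr (_ - _).
  rewrite /gauss_factor.
  rewrite (_ : (expR _)%:C = cexp (- (s * t ^+ 2 / 2)) 0); last first.
    by rewrite /cexp cos0 sin0 mulr1 mulr0.
  by rewrite -cexpD; congr cexp; field.
rewrite Normc.normcM nT -[leRHS]mul1r ler_pM ?expR_ge0//.
- by case: (_ - _) => x y /=; rewrite sqrtr_ge0.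
- by rewrite -expR0 ler_expR oppr_le0 divr_ge0// mulr_ge0 ?sqr_ge0.
have sS' : 0 <= s <= S by rewrite s0.
have w4 : `|t| + `|th| <= tau + 4.
  by rewrite lerD// (le_trans thpi)//; have := @pihalf_lt2 R; lra.
have := laplace_near_gaussian p0 mass mean var third sS' w4 tt.
by rewrite (_ : 1 + (tau + 4) = 5 + tau)//; ring.
Qed.

(** Half of the Gaussian decay absorbs the cube of the rescaled frequency. *)
Lemma cube_le_expR (c u : R) : 0 < c -> 0 <= u ->
  u ^+ 3 <= (1 + 8 / c ^+ 2) * expR (c * u ^+ 2 / 2).
Proof.
move=> c0 u0; have q0 : 0 <= c * u ^+ 2 / 2.
  by rewrite divr_ge0// mulr_ge0 ?sqr_ge0 ?ltW.
have := expR_ge1Dxn 1 q0; rewrite /= (_ : 2`!%:R = 2 :> R)// => q1.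
have q2 : u ^+ 4 <= 8 / c ^+ 2 * expR (c * u ^+ 2 / 2).
  rewrite [leLHS](_ : _ = 8 / c ^+ 2 * ((c * u ^+ 2 / 2) ^+ 2 / 2)); last first.
    by field; rewrite gt_eqF.
  rewrite ler_wpM2l//; last by move: q1; lra.
  by rewrite divr_ge0// sqr_ge0.
have q3 : u ^+ 3 <= 1 + u ^+ 4.
  have [u1|u1] := leP u 1.
    have : u ^+ 3 <= 1 by rewrite exprn_ile1.
    have : 0 <= u ^+ 4 by rewrite exprn_ge0.
    by lra.
  have : u ^+ 3 <= u ^+ 4.
    by rewrite [leRHS]exprSr -[leLHS]mulr1 ler_wpM2l ?exprn_ge0// ltW.
  by lra.
have q4 : 0 <= (c * u ^+ 2 / 2) ^+ 2 / 2 by rewrite divr_ge0// sqr_ge0.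
by move: q1 q2 q3 q4; lra.
Qed.

Section combine.
Variables (tau S M kappa v L : R).
Hypotheses (kappa_gt0 : 0 < kappa) (v_gt0 : 0 < v).
Hypotheses (tau_ge0 : 0 <= tau) (S_ge0 : 0 <= S) (M_ge0 : 0 <= M).
Hypothesis (L_ge0 : 0 <= L).

Let c := decay_const tau S M kappa v.
Let c_gt0 : 0 < c. Proof. exact: decay_const_gt0. Qed.
Let A := cube_const S M (tau + 4).
Let A_ge0 : 0 <= A.
Proof.
by rewrite /A /cube_const !addr_ge0 ?mulr_ge0 ?exprn_ge0 ?addr_ge0 ?expR_ge0.
Qed.
Let G := expR (2 * M * L + (1 + tau) ^+ 2 + 16 * c).
Let C0 := 4 * A + (5 + tau) ^+ 2 + 4 * A * (1 + 8 / c ^+ 2).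

Variables (I : finType) (n : nat).
Hypothesis n_gt0 : (0 < n)%N.
Let nu := Num.sqrt n%:R : R.
Variables (p Y : 'I_n -> I -> R) (s : 'I_n -> R) (t : R).
Hypothesis p_regular : forall j,
  regular_step (p j) (Y j) (s j) (n%:R * nu)^-1 tau S M kappa v.
Hypotheses (t_tau : `|t| <= tau) (nt3 : n%:R * `|t| ^+ 3 <= L).

Let nR_ge1 : 1 <= n%:R :> R. Proof. by rewrite ler1n. Qed.
Let nu_ge1 : 1 <= nu. Proof. by rewrite -sqrtr1 ler_wsqrtr. Qed.
Let nu_gt0 : 0 < nu. Proof. by rewrite (lt_le_trans _ nu_ge1). Qed.
Let nu_sqr : nu ^+ 2 = n%:R. Proof. by rewrite sqr_sqrtr. Qed.

(** Telescoping costs [n (|t| + |th|)^3 rho^(n - 1)].  As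
    [rho^(n - 1)] is of order [exp (- c n th^2)] while [n |t|^3 <= L], the part
    [n |th|^3] of the cube, which is [n^(-1/2) (n^(1/2) |th|)^3], becomes
    [O(n^(-1/2))] by [cube_le_expR].  The truncation error [e] is chosen as
    [n^(-3/2)] for its total [n e] to be of that order too. *)
Lemma prod_factors_near_gaussian (th : R) : `|th| <= pi ->
  normc (\prod_j ((expR (- (s j * t ^+ 2 / 2)))%:C * laplace (p j) (Y j) t th) -
         \prod_j gauss_factor (s j) t th)
  <= C0 * G * (n%:R * `|t| ^+ 3 + nu^-1) * expR (- (c * n%:R / 2 * th ^+ 2)).
Proof.
move=> thpi.
have e0 : 0 <= (n%:R * nu)^-1 by rewrite invr_ge0 mulr_ge0// ltW.
have e1 : (n%:R * nu)^-1 <= 1.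
  by rewrite invf_le1 ?mulr_gt0 ?ltr0n// mulr_ege1.
have st j := step_factors (p_regular j) kappa_gt0 v_gt0 e1 t_tau thpi.
apply: le_trans (normc_prod_sub _ _ _) _.
- by move=> j; case: (st j) => h _ _; exact: h.
- by move=> j; case: (st j) => _ h _; exact: h.
- by move=> j; case: (st j) => _ _ h; exact: h.
rewrite -/A -/c -expRM_natl.
have th0 : 0 <= th ^+ 2 by rewrite sqr_ge0.
have th16 : th ^+ 2 <= 16.
  rewrite -real_normK ?num_real// (_ : 16 = 4 ^+ 2); last by ring.
  rewrite lerXn2r ?nnegrE// (le_trans thpi)//.
  by have := @pihalf_lt2 R; lra.
have nE : n%:R * ((n%:R * nu)^-1 * (1 + `|t|) ^+ 2) <= (1 + tau) ^+ 2.
  rewrite (_ : n%:R * _ = nu^-1 * (1 + `|t|) ^+ 2); last first.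
    by field; rewrite gt_eqF//= pnatr_eq0 -lt0n.
  rewrite -[leRHS]mul1r ler_pM ?invr_ge0 ?exprn_ge0 ?addr_ge0 ?(ltW nu_gt0)//.
    by rewrite invf_le1.
  by rewrite lerXn2r ?nnegrE ?addr_ge0 ?lerD2l.
have t3 : 0 <= M * `|t| ^+ 3 by rewrite mulr_ge0 ?exprn_ge0.
have et : 0 <= (n%:R * nu)^-1 * (1 + `|t|) ^+ 2.
  by rewrite mulr_ge0 ?exprn_ge0 ?addr_ge0.
have mt3 : M * (n%:R * `|t| ^+ 3) <= M * L by rewrite ler_wpM2l.
have nn : n.-1%:R = n%:R - 1 :> R by rewrite -subn1 natrB.
have expo : n.-1%:R * (2 * M * `|t| ^+ 3 + (n%:R * nu)^-1 * (1 + `|t|) ^+ 2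
     - c * th ^+ 2)
   <= (2 * M * L + (1 + tau) ^+ 2 + 16 * c) - c * n%:R * th ^+ 2.
  have c16 : c * th ^+ 2 <= c * 16 by rewrite ler_wpM2l// ltW.
  by rewrite nn; move: nE t3 et mt3 c16; lra.
have {}expo : expR (n.-1%:R * (2 * M * `|t| ^+ 3
     + (n%:R * nu)^-1 * (1 + `|t|) ^+ 2 - c * th ^+ 2))
   <= G * (expR (- (c * n%:R / 2 * th ^+ 2)) * expR (- (c * n%:R / 2 * th ^+ 2))).
  rewrite -!expRD ler_expR (le_trans expo)// le_eqVlt; apply/orP; left.
  by apply/eqP; field.
set X := expR (- _) in expo *.
have X0 : 0 <= X by rewrite expR_ge0.
have X1 : X <= 1.
  by rewrite -expR0 ler_expR oppr_le0 mulr_ge0// divr_ge0// mulr_ge0// ltW.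
have G0 : 0 <= G by rewrite expR_ge0.
have cube : (nu * `|th|) ^+ 3 * X <= 1 + 8 / c ^+ 2.
  have : (nu * `|th|) ^+ 3 <= (1 + 8 / c ^+ 2) * expR (c * (nu * `|th|) ^+ 2 / 2).
    by apply: cube_le_expR => //; rewrite mulr_ge0// ltW.
  rewrite (exprMn 2 nu) nu_sqr (real_normK (num_real th)) => h.
  apply: (le_trans (ler_wpM2r X0 h)).
  rewrite /= -(mulrA (1 + _)) /X -expRD [X in expR X](_ : _ = 0) ?expR0 ?mulr1//.
  by field.
have sum3 : (`|t| + `|th|) ^+ 3 <= 4 * (`|t| ^+ 3 + `|th| ^+ 3).
  rewrite -subr_ge0.
  rewrite (_ : _ - _ = 3 * (`|t| + `|th|) * (`|t| - `|th|) ^+ 2); last by ring.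
  by rewrite mulr_ge0 ?sqr_ge0// mulr_ge0 ?addr_ge0.
set r := n%:R * `|t| ^+ 3 + nu^-1.
have nt0 : 0 <= n%:R * `|t| ^+ 3 by rewrite mulr_ge0 ?exprn_ge0.
have nui0 : 0 <= nu^-1 by rewrite invr_ge0 ltW.
have nth : n%:R * `|th| ^+ 3 = nu^-1 * (nu * `|th|) ^+ 3.
  by rewrite -nu_sqr; field; rewrite gt_eqF.
have main : n%:R * (A * (`|t| + `|th|) ^+ 3 + (n%:R * nu)^-1 * (5 + tau) ^+ 2) * X
   <= C0 * r.
  apply: (@le_trans _ _ ((4 * A * (n%:R * `|t| ^+ 3) + nu^-1 * (5 + tau) ^+ 2) * X
      + 4 * A * nu^-1 * ((nu * `|th|) ^+ 3 * X))).
    rewrite (mulrA (4 * A * nu^-1)) -(mulrA (4 * A) nu^-1) -nth -mulrDl.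
    rewrite ler_wpM2r// mulrDr.
    have -> : n%:R * ((n%:R * nu)^-1 * (5 + tau) ^+ 2) = nu^-1 * (5 + tau) ^+ 2.
      by field; rewrite gt_eqF//= pnatr_eq0 -lt0n.
    have : n%:R * A * (`|t| + `|th|) ^+ 3 <=
      n%:R * A * (4 * (`|t| ^+ 3 + `|th| ^+ 3)) by rewrite ler_wpM2l ?mulr_ge0.
    by lra.
  have f1 : (4 * A * (n%:R * `|t| ^+ 3) + nu^-1 * (5 + tau) ^+ 2) * X <=
     4 * A * (n%:R * `|t| ^+ 3) + nu^-1 * (5 + tau) ^+ 2.
    have f11 : 0 <= 4 * A * (n%:R * `|t| ^+ 3) by rewrite mulr_ge0// mulr_ge0.
    have f12 : 0 <= nu^-1 * (5 + tau) ^+ 2 by rewrite mulr_ge0// sqr_ge0.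
    by rewrite ler_piMr// addr_ge0.
  have f2 : 4 * A * nu^-1 * ((nu * `|th|) ^+ 3 * X) <=
     4 * A * nu^-1 * (1 + 8 / c ^+ 2) by rewrite ler_wpM2l ?mulr_ge0.
  have c8 : 0 <= 8 / c ^+ 2 by rewrite divr_ge0// sqr_ge0.
  have f3 : 0 <= 4 * A * nu^-1 by rewrite !mulr_ge0.
  have f4 : 0 <= (5 + tau) ^+ 2 * (n%:R * `|t| ^+ 3).
    by rewrite mulr_ge0 ?sqr_ge0.
  have f5 : 0 <= 4 * A * (1 + 8 / c ^+ 2) * (n%:R * `|t| ^+ 3).
    by rewrite mulr_ge0// !mulr_ge0// addr_ge0.
  by rewrite /C0 /r; move: f1 f2 f3 f4 f5; lra.
have w0 : 0 <= `|t| + `|th| by rewrite addr_ge0.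
have eta0 : 0 <= A * (`|t| + `|th|) ^+ 3 + (n%:R * nu)^-1 * (5 + tau) ^+ 2.
  by apply: addr_ge0; apply: mulr_ge0; rewrite ?exprn_ge0// addr_ge0.
apply: (le_trans (ler_wpM2l (mulr_ge0 (ler0n _ n) eta0) expo)).
rewrite [leLHS](_ : _ = n%:R *
  (A * (`|t| + `|th|) ^+ 3 + (n%:R * nu)^-1 * (5 + tau) ^+ 2) * X * (G * X)).
  rewrite [leRHS](_ : _ = C0 * r * (G * X)); last by ring.
  by rewrite ler_wpM2r// mulr_ge0.
by ring.
Qed.

End combine.

Lemma prod_laplace (I : finType) (n : nat) (p Y : 'I_n -> I -> R) (t th : R) :
  \prod_j laplace (p j) (Y j) t th =
  \sum_(f : {ffun 'I_n -> I}) (\prod_j p j (f j))%:C *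
     cexp (t * \sum_j Y j (f j)) (th * \sum_j Y j (f j)).
Proof.
rewrite /laplace bigA_distr_bigA; apply: eq_bigr => f _.
by rewrite big_split/= !mulr_sumr cexp_sum -rmorph_prod.
Qed.

Lemma cexp0_mul_real (a : R) : cexp a 0 = (expR a)%:C.
Proof. by rewrite /cexp cos0 sin0 mulr1 mulr0. Qed.

Lemma Re_real_mul (a : R) (z : R[i]) : complex.Re (a%:C * z) = a * complex.Re z.
Proof. by case: z => x y /=; rewrite mul0r subr0. Qed.

Lemma Re_sum (J : finType) (F : J -> R[i]) :
  complex.Re (\sum_j F j) = \sum_j complex.Re (F j).
Proof. by elim/big_rec2 : _ => [//|j x z _ <-]; case: z; case: (F j). Qed.

(** The local limit theorem for truncated steps, where the probability of
    [S_n = y] is a sum over paths [f].  The function [h] below is the integrand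
    of the inversion formula times [exp (B t^2 / 2)], written as a trigonometric
    polynomial; [hE] writes it as a product over the steps. *)
Lemma finite_local_limit (tau S M kappa v L : R) :
  0 < kappa -> 0 < v -> 0 <= tau -> 0 <= S -> 0 <= M -> 0 <= L ->
  exists C : R, 0 <= C /\
  forall (I : finType) (n : nat) (p : 'I_n -> I -> R) (pos : I -> int)
    (m s : 'I_n -> R) (t : R) (y : int), (0 < n)%N ->
  (forall j, regular_step (p j) (fun u => (pos u)%:~R - m j) (s j)
     (n%:R * Num.sqrt n%:R)^-1 tau S M kappa v) ->
  `|t| <= tau -> n%:R * `|t| ^+ 3 <= L ->
  y%:~R - \sum_j m j = (\sum_j s j) * t ->
  let B := \sum_j s j in
  `|Num.sqrt (2 * pi * B) * expR ((y%:~R - \sum_j m j) ^+ 2 / (2 * B)) *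
     (\sum_(f : {ffun 'I_n -> I} | \sum_j pos (f j) == y) \prod_j p j (f j)) - 1|
  <= C * (n%:R * `|t| ^+ 3 + (Num.sqrt n%:R)^-1).
Proof.
move=> k0 v0 tau0 S0 M0 L0.
set c := decay_const tau S M kappa v.
have c0 : 0 < c by exact: decay_const_gt0.
set C1 := (4 * cube_const S M (tau + 4) + (5 + tau) ^+ 2 +
   4 * cube_const S M (tau + 4) * (1 + 8 / c ^+ 2)) *
   expR (2 * M * L + (1 + tau) ^+ 2 + 16 * c).
have A0 : 0 <= cube_const S M (tau + 4).
  by rewrite /cube_const !addr_ge0 ?mulr_ge0 ?exprn_ge0 ?addr_ge0 ?expR_ge0.
have c8 : 0 <= 1 + 8 / c ^+ 2 by rewrite addr_ge0// divr_ge0// sqr_ge0.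
have C10 : 0 <= C1.
  apply: mulr_ge0; last exact: expR_ge0.
  apply: addr_ge0; last by apply: mulr_ge0 => //; exact: mulr_ge0.
  by apply: addr_ge0; [exact: mulr_ge0|exact: sqr_ge0].
have c20 : 0 <= 2 / c by rewrite divr_ge0// ltW.
exists ((C1 + 2 / c) * Num.sqrt (S / c)); split.
  by rewrite mulr_ge0 ?sqrtr_ge0// addr_ge0.
move=> I n p pos m s t y n0 reg tt nt3.
set x := y%:~R - _; set B := \sum_j s j => xBt /=.
set nu := Num.sqrt n%:R in reg *.
set P := \sum_(f | _) _.
have n1 : 1 <= n%:R :> R by rewrite ler1n.
have ngt0 : 0 < n%:R :> R by rewrite ltr0n.
have nu1 : 1 <= nu by rewrite -sqrtr1 ler_wsqrtr.
have nu0 : 0 < nu by rewrite (lt_le_trans _ nu1).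
have nu2 : nu ^+ 2 = n%:R by rewrite sqr_sqrtr.
set r := n%:R * `|t| ^+ 3 + nu^-1.
have nt0 : 0 <= n%:R * `|t| ^+ 3 by rewrite mulr_ge0 ?exprn_ge0.
have r0 : 0 <= r by rewrite addr_ge0// invr_ge0 ltW.
have sv j : v <= s j by have [_ _ _ _ _ /andP[]] := reg j.
have sS j : s j <= S by have [_ _ _ _ _ /andP[]] := reg j.
have vB : v * n%:R <= B.
  rewrite mulr_natr -[X in _ *+ X]card_ord -sumr_const.
  by apply: ler_sum => j _.
have BS : B <= S * n%:R.
  rewrite mulr_natr -[X in _ *+ X]card_ord -sumr_const.
  by apply: ler_sum => j _.
have B0 : 0 < B by rewrite (lt_le_trans _ vB)// mulr_gt0.
have cv : c <= v / 2 by rewrite ge_min lexx.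
pose w (f : {ffun 'I_n -> I}) := expR (B * t ^+ 2 / 2) *
  (\prod_j p j (f j) * expR (t * ((\sum_j pos (f j)) - y)%:~R)).
pose l (f : {ffun 'I_n -> I}) : int := \sum_j pos (f j) - y.
pose h th := \sum_f w f * cos ((l f)%:~R * th).
have hE th : h th = complex.Re (cexp 0 (- (th * x)) *
    \prod_j ((expR (- (s j * t ^+ 2 / 2)))%:C *
      laplace (p j) (fun u => (pos u)%:~R - m j) t th)).
  rewrite big_split/= prod_laplace -rmorph_prod -expR_sum mulrCA Re_real_mul.
  rewrite mulr_sumr Re_sum mulr_sumr; apply: eq_bigr => f _.
  have sumY : \sum_j ((pos (f j))%:~R - m j) = (l f)%:~R + x :> R.
    by rewrite sumrB /l /x rmorphB/= rmorph_sum/=; ring.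
  rewrite mulrCA Re_real_mul -cexpD sumY /cexp /=.
  have -> : - (th * x) + th * ((l f)%:~R + x) = (l f)%:~R * th by ring.
  have -> : \sum_j - (s j * t ^+ 2 / 2) = - (B * t ^+ 2 / 2).
    by rewrite sumrN /B !mulr_suml.
  rewrite /w -/(l f) add0r mulrDr xBt (expRD (t * (l f)%:~R)).
  have -> : expR (t * (B * t)) = expR (B * t ^+ 2 / 2) * expR (B * t ^+ 2 / 2).
    by rewrite -expRD; congr expR; field.
  rewrite expRN; field.
  by rewrite gt_eqF// expR_gt0.
(* the choice of [t] cancels the phase: [B * t - x = 0] *)
have gE th : cexp 0 (- (th * x)) * \prod_j gauss_factor (s j) t th =
    (expR (- (B / 2 * th ^+ 2)))%:C.
  rewrite -cexp_sum -cexpD -mulr_suml -/B xBt add0r.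
  have -> : - (th * (B * t)) + B * (t * th) = 0 by ring.
  rewrite cexp0_mul_real; congr (expR _)%:C.
  by rewrite sumrN /B !mulr_suml; congr (- _); apply: eq_bigr => j _; ring.
have hin th : `|th| <= pi -> `|h th - expR (- (B / 2 * th ^+ 2))| <=
    (C1 + 2 / c) * r * expR (- (c * n%:R / 2 * th ^+ 2)).
  move=> thpi.
  have := prod_factors_near_gaussian k0 v0 tau0 S0 M0 n0 reg tt nt3 thpi.
  rewrite -/c -/nu -/r -/C1 => H.
  have -> : h th - expR (- (B / 2 * th ^+ 2)) = complex.Re (cexp 0 (- (th * x)) *
     (\prod_j ((expR (- (s j * t ^+ 2 / 2)))%:C *
        laplace (p j) (fun u => (pos u)%:~R - m j) t th) -
      \prod_j gauss_factor (s j) t th)).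
    by rewrite mulrBr gE hE; case: (cexp _ _ * _) => a b.
  apply: (le_trans (norm_Re_le _)).
  rewrite Normc.normcM normc_cexp expR0 mul1r (le_trans H)//.
  by rewrite ler_wpM2r ?expR_ge0// ler_wpM2r// lerDl.
(* outside of the period the Gaussian itself is an error term: there
   [th^2 >= 1], so half of its decay gives a factor [2 / (c n)] *)
have hout th : pi < `|th| -> expR (- (B / 2 * th ^+ 2)) <=
    (C1 + 2 / c) * r * expR (- (c * n%:R / 2 * th ^+ 2)).
  move=> thpi.
  have th1 : 1 <= th ^+ 2.
    rewrite -real_normK ?num_real// -(expr1n _ 2) lerXn2r ?nnegrE//.
    by rewrite (le_trans _ (ltW thpi))//; have := @pi_ge2 R; lra.
  have th0 : 0 <= th ^+ 2 by rewrite sqr_ge0.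
  apply: (@le_trans _ _ (expR (- (c * n%:R / 2 * th ^+ 2)) *
                         expR (- (c * n%:R / 2 * th ^+ 2)))).
    rewrite -expRD ler_expR -opprD lerN2 -mulrDl ler_wpM2r//.
    have : c * n%:R <= v / 2 * n%:R by rewrite ler_wpM2r.
    by lra.
  rewrite ler_wpM2r ?expR_ge0//.
  apply: (@le_trans _ _ (2 / c * nu^-1)); last first.
    by rewrite ler_pM ?lerDr ?lerDl// ?invr_ge0 ltW.
  rewrite expRN; apply: (@le_trans _ _ (2 / c * n%:R^-1)); last first.
    rewrite ler_wpM2l// lef_pV2 ?posrE// -nu2 expr2.
    by rewrite -[leLHS]mulr1 ler_wpM2l// ltW.
  rewrite (_ : 2 / c * n%:R^-1 = (c * n%:R / 2)^-1); last first.
    by field; rewrite !gt_eqF.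
  have cn0 : 0 < c * n%:R / 2 by rewrite divr_gt0// mulr_gt0.
  rewrite lef_pV2 ?posrE ?expR_gt0//.
  have := expR_ge1Dx (c * n%:R / 2 * th ^+ 2).
  have : c * n%:R / 2 * 1 <= c * n%:R / 2 * th ^+ 2.
    by rewrite ler_wpM2l// ltW.
  by lra.
have B20 : 0 < B / 2 by rewrite divr_gt0.
have cn0 : 0 < c * n%:R / 2 by rewrite divr_gt0// mulr_gt0.
have ch : {within `[- pi, pi], continuous h}.
  exact/continuous_subspaceT/continuous_trig_poly.
have := Rintegral_near_gaussian ch B20 cn0 hin hout.
rewrite Rintegral_trig_poly.
have -> : \sum_(f | l f == 0) w f = expR (B * t ^+ 2 / 2) * P.
  rewrite /P mulr_sumr; apply: eq_big => f; first by rewrite /l subr_eq0.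
  rewrite /w /l => /eqP ->.
  by rewrite mulr0 expR0 mulr1.
have -> : x ^+ 2 / (2 * B) = B * t ^+ 2 / 2.
  by rewrite xBt; field; rewrite gt_eqF.
set E := expR _.
have := @pi_gt0 R.
(* [pi] is generalised, as [field] would unfold its definition *)
move: (@pi R) => q q0.
set a := Num.sqrt (2 * q * B).
have a0 : 0 < a by rewrite sqrtr_gt0 !mulr_gt0.
have a2 : a ^+ 2 = 2 * q * B by rewrite sqr_sqrtr// ltW// !mulr_gt0.
have sB : Num.sqrt (q / (B / 2)) = 2 * q / a.
  rewrite -[RHS]ger0_norm; last by rewrite divr_ge0 ?mulr_ge0 ?ltW.
  rewrite -sqrtr_sqr; congr Num.sqrt; rewrite exprMn exprVn a2.
  by field;
    rewrite ?(gt_eqF a0) ?(gt_eqF B0) ?(gt_eqF c0) ?(gt_eqF q0) ?(gt_eqF ngt0).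
have sc : a * Num.sqrt (q / (c * n%:R / 2)) <= 2 * q * Num.sqrt (S / c).
  have q20 : 0 <= 2 * q by rewrite mulr_ge0// ltW.
  rewrite -(ger0_norm q20) -sqrtr_sqr /a -!sqrtrM ?sqr_ge0//; last first.
    by rewrite mulr_ge0// ltW.
  apply: ler_wsqrtr.
  rewrite [leLHS](_ : _ = (2 * q) ^+ 2 * (B / (c * n%:R))); last first.
    by field;
    rewrite ?(gt_eqF a0) ?(gt_eqF B0) ?(gt_eqF c0) ?(gt_eqF q0) ?(gt_eqF ngt0).
  rewrite ler_wpM2l ?sqr_ge0// ler_pdivrMr ?mulr_gt0//.
  by rewrite [leRHS](_ : _ = S * n%:R)//; field;
    rewrite ?(gt_eqF a0) ?(gt_eqF B0) ?(gt_eqF c0) ?(gt_eqF q0) ?(gt_eqF ngt0).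
rewrite sB => H.
have -> : a * E * P - 1 = a / (2 * q) * (2 * q * (E * P) - 2 * q / a).
  by field;
    rewrite ?(gt_eqF a0) ?(gt_eqF B0) ?(gt_eqF c0) ?(gt_eqF q0) ?(gt_eqF ngt0).
have ap0 : 0 <= a / (2 * q) by rewrite divr_ge0 ?mulr_ge0 ?ltW.
rewrite normrM (ger0_norm ap0); apply: (le_trans (ler_wpM2l ap0 H)).
rewrite [leLHS](_ : _ = (C1 + 2 / c) * r / (2 * q) *
   (a * Num.sqrt (q / (c * n%:R / 2)))); last by field;
    rewrite ?(gt_eqF a0) ?(gt_eqF B0) ?(gt_eqF c0) ?(gt_eqF q0) ?(gt_eqF ngt0).
rewrite [leRHS](_ : _ = (C1 + 2 / c) * r / (2 * q) *
   (2 * q * Num.sqrt (S / c))); last by field;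
    rewrite ?(gt_eqF a0) ?(gt_eqF B0) ?(gt_eqF c0) ?(gt_eqF q0) ?(gt_eqF ngt0).
apply: ler_wpM2l sc; apply: divr_ge0; last by rewrite mulr_ge0// ltW.
by apply: mulr_ge0 => //; exact: addr_ge0.
Qed.

End finite_local_limit.

(** * Aperiodicity and the spread of a sequence *)

Section aperiodicity.
Context {R : realType}.
Variable p : probability int R.

Lemma nstep_walk_ge0 n x y : (0 <= nstep (walk_kernel p) n x y)%E.
Proof.
elim: n x => [|n IH] x /=; first by rewrite lee_fin ler0n.
by apply: esum_ge0 => z _; rewrite mule_ge0// measure_ge0.
Qed.

Section subgroup.
Variables (H : int -> Prop) (r : int).
Hypotheses (H0 : H 0) (HB : forall i j, H i -> H j -> H (i - j)).

Let HN i : H i -> H (- i). Proof. by rewrite -sub0r; exact: HB. Qed.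
Let HD i j : H i -> H j -> H (i + j).
Proof. by move=> Hi Hj; rewrite -[j]opprK; apply/HB/HN. Qed.
Let HMn i n : H i -> H (i *+ n).
Proof. by move=> Hi; elim: n => [|n IH]; rewrite ?mulr0n// mulrS; exact: HD. Qed.

Hypothesis supp_H : forall k, (0 < p [set k])%E -> H (k - r).

(** Every step is [r] modulo [H], so the time determines the position
    modulo [H]. *)
Lemma nstep_subgroup n x y :
  (0 < nstep (walk_kernel p) n x y)%E -> H (y - x - r *+ n).
Proof.
elim: n x => [|n IH] x /=.
  rewrite mulr0n subr0; case: eqVneq => [->|_]; first by rewrite subrr.
  by rewrite ltxx.
move=> esum_pos.
have [z] : exists z, (0 < walk_kernel p x z * nstep (walk_kernel p) n z y)%E.
  apply: contrapT => /forallNP none; move: esum_pos.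
  rewrite esum1 ?ltxx// => z _; apply/eqP; rewrite eq_le mule_ge0 ?measure_ge0//.
    by rewrite andbT leNgt; apply/negP/none.
  exact: nstep_walk_ge0.
rewrite lt0e mule_eq0 negb_or => /andP[/andP[K0 N0] _].
have {}K0 : H (z - x - r) by apply: supp_H; rewrite lt0e K0 measure_ge0.
have {}N0 : H (y - z - r *+ n) by apply: IH; rewrite lt0e N0 nstep_walk_ge0.
by have := HD K0 N0; congr H; rewrite mulrS; ring.
Qed.

(** A subgroup [H] that contains the differences of the support is everything.
    In the quotient by [H] every step equals [r].  By irreducibility [1] is a
    multiple of [r] there, so a return time [n], for which [n r] vanishes in the
    quotient, lies in [H] itself.  If [H] is generated by [q > 0], then [q]
    divides all return times, and [q = 1]; if [H] is zero there is no return
    time, which contradicts aperiodicity. *)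
Lemma subgroup_support_differences :
  irreducible_measure p -> aperiodic_measure p -> H 1.
Proof.
move=> irr aper.
have [n1] := irr 0 1; move/nstep_subgroup; rewrite subr0 => H1.
have ret n : (0 < nstep (walk_kernel p) n 0%R 0%R)%E -> H n%:Z.
  move/nstep_subgroup; rewrite subrr sub0r => /HN; rewrite opprK => Hn.
  have := HD (HMn n H1) (HMn n1 Hn).
  by rewrite mulrnBl -!mulrnA (mulnC n) subrK natz.
pose Q (q : nat) := (0 < q)%N && `[< H q%:Z >].
have [exQ|none] := pselect (exists q, Q q); last first.
  have : 2%N = 1%N by apply: (aper 0) => m m0 /ret Hm; exfalso; apply: none;
    exists m; rewrite /Q m0; exact/asboolP.
  by [].
have [q /andP[q0 /asboolP Hq] qmin] := ex_minnP exQ.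
suff -> : 1 = q%:Z by [].
congr Posz; apply/esym/(aper 0) => m m0 /ret Hm.
have Hr : H (m %% q)%N%:Z.
  have := HB Hm (HMn (m %/ q)%N Hq); congr H.
  rewrite {1}(divn_eq m q) PoszD PoszM -mulr_natr natz; ring.
rewrite /dvdn; have [//|r0] := posnP (m %% q)%N.
have := qmin (m %% q)%N; rewrite /Q r0 (asboolT Hr) => /(_ isT).
by rewrite leqNgt ltn_pmod.
Qed.

End subgroup.

(** [1 - cos u] is half of the squared length of [exp (i u) - 1], and the
    length is subadditive in [u]. *)
Lemma one_sub_cosD (u w : R) :
  1 - cos (u + w) <= 2 * (1 - cos u) + 2 * (1 - cos w).
Proof.
rewrite !one_sub_cos (mulrDl u w) sinD.
set a := u / 2; set b := w / 2.
suff : (sin a * cos b + cos a * sin b) ^+ 2 <= 2 * (sin a ^+ 2 + sin b ^+ 2).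
  by lra.
have ca := sin2cos2 a; have cb := sin2cos2 b.
have a0 : 0 <= sin a ^+ 2 by rewrite sqr_ge0.
have b0 : 0 <= sin b ^+ 2 by rewrite sqr_ge0.
have h1 : sin a ^+ 2 * cos b ^+ 2 <= sin a ^+ 2.
  by rewrite ler_piMr// cos2sin2 gerBl.
have h2 : cos a ^+ 2 * sin b ^+ 2 <= sin b ^+ 2.
  by rewrite ler_piMl// cos2sin2 gerBl.
have h3 : 0 <= (sin a * cos b - cos a * sin b) ^+ 2 by rewrite sqr_ge0.
have -> : (sin a * cos b + cos a * sin b) ^+ 2 =
  2 * (sin a ^+ 2 * cos b ^+ 2 + cos a ^+ 2 * sin b ^+ 2)
   - (sin a * cos b - cos a * sin b) ^+ 2 by ring.
by lra.
Qed.

Lemma one_sub_cosB (u w : R) :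
  1 - cos (u - w) <= 2 * (1 - cos u) + 2 * (1 - cos w).
Proof. by have := one_sub_cosD u (- w); rewrite (cosN w). Qed.

End aperiodicity.

(** [-K .. K - 1], indexed by a finite type that grows with [K]. *)
Notation box K := (bool * 'I_K)%type.

Section boxes.
Context {R : realType}.

Definition boxval K (u : box K) : int :=
  if u.1 then Posz u.2 else Negz u.2.

Lemma boxval_inj K : injective (@boxval K).
Proof.
move=> [[] i] [[] j] //=; rewrite /boxval/= => -[ij];
  by congr (_, _); apply: val_inj.
Qed.

Lemma sum_box K (g : int -> R) :
  \sum_(u : box K) g (boxval u) = \sum_(i < K) (g (Posz i) + g (Negz i)).
Proof.
rewrite big_split/= -(pair_bigA _ (fun (b : bool) (i : 'I_K) =>
  g (if b then Posz i else Negz i)))/=.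
by rewrite big_bool.
Qed.

Lemma le_sum_box K K' (g : int -> R) : (K <= K')%N -> (forall k, 0 <= g k) ->
  \sum_(u : box K) g (boxval u) <= \sum_(u : box K') g (boxval u).
Proof.
move=> KK g0; rewrite !sum_box -!(big_mkord xpredT (fun i => g i + g (Negz i))).
rewrite (big_cat_nat (leq0n K) KK)//= lerDl sumr_ge0// => i _; exact: addr_ge0.
Qed.

Lemma mem_box (k : int) K : (`|k|%N < K)%N -> exists u : box K, boxval u = k.
Proof.
case: k => n nK; first by exists (true, Ordinal nK).
by exists (false, Ordinal (ltnW nK)).
Qed.

End boxes.

Section spread.
Context {R : realType}.

Definition spread (a : int -> R) (N : nat) (th : R) : R :=
  \sum_(u : box N) \sum_(w : box N) a (boxval u) * a (boxval w) *
    (1 - cos (th * (boxval u - boxval w)%:~R)).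

Lemma le_spread (a b : int -> R) N N' th : (N <= N')%N ->
  (forall k, 0 <= a k <= b k) -> spread a N th <= spread b N' th.
Proof.
move=> NN ab.
have b0 k : 0 <= b k by case/andP: (ab k); exact: le_trans.
have c0 := @one_sub_cos_ge0 R.
apply: (@le_trans _ _ (spread b N th)).
  apply: ler_sum => u _; apply: ler_sum => w _; rewrite ler_wpM2r//.
  case/andP: (ab (boxval u)) => a0 h; case/andP: (ab (boxval w)) => a0' h'.
  by rewrite ler_pM.
apply: (@le_trans _ _ (\sum_(u : box N) \sum_(w : box N') b (boxval u) *
    b (boxval w) * (1 - cos (th * (boxval u - boxval w)%:~R)))).
  apply: ler_sum => u _.
  apply: (@le_sum_box _ _ _ (fun k => b (boxval u) *
    b k * (1 - cos (th * (boxval u - k)%:~R)))) => // k.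
  by rewrite !mulr_ge0.
apply: (@le_sum_box _ _ _ (fun i => \sum_(w : box N') b i *
    b (boxval w) * (1 - cos (th * (i - boxval w)%:~R)))) => // k.
by apply: sumr_ge0 => w _; rewrite !mulr_ge0.
Qed.

(** The integers [d] for which [1 - cos (d th)] is dominated by a finite window
    of the double sum form a subgroup, by [one_sub_cosB], and this subgroup
    contains the differences of the support: for [d = k - r] one term of the
    double sum suffices. *)
Lemma aperiodic_spread (a : int -> R) : (forall i, 0 <= a i) ->
  irreducible_aperiodic_seq a ->
  exists (C : R) (N : nat), 0 < C /\
    forall th, 1 - cos th <= C * spread a N th.
Proof.
move=> a0 [p [irr aper [b [b0 ab]]]].
have c0 := @one_sub_cos_ge0 R.
have aa k : 0 <= a k <= a k by rewrite a0 lexx.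
have s0 N th : 0 <= spread a N th.
  by apply: sumr_ge0 => u _; apply: sumr_ge0 => w _; rewrite !mulr_ge0.
pose H (d : int) := exists (C : R) (N : nat), 0 < C /\
  forall th, 1 - cos (th * d%:~R) <= C * spread a N th.
have H0 : H 0.
  by exists 1, 0%N; split=> // th; rewrite mulr0 cos0 subrr mul1r.
have HB i j : H i -> H j -> H (i - j).
  move=> [C [N [C0 h]]] [C' [N' [C0' h']]].
  exists (2 * C + 2 * C'), (maxn N N'); split.
    by rewrite addr_gt0// mulr_gt0.
  move=> th; rewrite rmorphB/= mulrBr; apply: (le_trans (one_sub_cosB _ _)).
  have l1 := le_spread th (leq_maxl N N') aa.
  have l2 := le_spread th (leq_maxr N N') aa.
  have m1 := ler_wpM2l (ltW C0) l1; have m2 := ler_wpM2l (ltW C0') l2.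
  by move: (h th) (h' th) m1 m2 => /=; lra.
have apos k : (0 < p [set k])%E -> 0 < a k.
  by move=> pk; rewrite -lte_fin ab mule_gt0// lte_fin.
have [r pr] : exists r, (0 < p [set r])%E.
  have [n] := irr 0 1; case: n => [|n] /=; first by rewrite ltxx.
  move=> pos; apply: contrapT => /forallNP none; move: pos.
  rewrite esum1 ?ltxx// => z _; rewrite /walk_kernel.
  have -> : p [set z - 0] = 0%E.
    by apply/eqP; rewrite eq_le measure_ge0 andbT leNgt; apply/negP/none.
  by rewrite mul0e.
have : H 1.
  apply: (subgroup_support_differences (p := p) (r := r)) => // k pk.
  have ak := apos _ pk; have ar := apos _ pr.
  exists (a k * a r)^-1, (maxn `|k| `|r|).+1.
  split; first by rewrite invr_gt0 mulr_gt0.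
  move=> th; rewrite [leRHS]mulrC ler_pdivlMr ?mulr_gt0//.
  have [u uk] := @mem_box k (maxn `|k| `|r|).+1 (leq_maxl _ _).
  have [w wr] := @mem_box r (maxn `|k| `|r|).+1 (leq_maxr _ _).
  rewrite /spread (bigD1 u)//= (bigD1 w)//= uk wr [leLHS]mulrC -addrA lerDl.
  apply: addr_ge0; first by apply: sumr_ge0 => *; rewrite !mulr_ge0.
  by apply: sumr_ge0 => *; apply: sumr_ge0 => *; rewrite !mulr_ge0.
move=> [C [N [C0 h]]]; exists C, N; split=> // th.
by have := h th; rewrite mulr1.
Qed.

End spread.

(** * Moments of integer-valued variables, by truncation *)

Section integer_valued.
Context {R : realType} {d : measure_display} {T : measurableType d}.
Variables (P : probability T R) (X : {RV P >-> int}).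

Definition mass (k : int) : R := fine (P (X @^-1` [set k])).

Lemma measurable_preim (A : set int) : measurable (X @^-1` A).
Proof. by rewrite -[X in measurable X]setTI; exact: measurable_funP. Qed.

Lemma massE k : (mass k)%:E = P (X @^-1` [set k]).
Proof. by rewrite /mass fineK// fin_num_measure//; exact: measurable_preim. Qed.

Lemma mass_ge0 k : 0 <= mass k.
Proof. by rewrite -lee_fin massE. Qed.

Lemma measurable_int_comp (g : int -> R) :
  measurable_fun [set: T] (EFin \o (fun w => g (X w))).
Proof.
apply/measurable_EFinP.
move=> _ Y mY; rewrite setTI.
exact: (measurable_preim (g @^-1` Y)).
Qed.

(** The truncation of [g (X w)] to a box, written with indicators so that its
    expectation is a finite sum of masses. *)
Definition box_part (g : int -> R) (K : nat) (w : T) : R :=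
  \sum_(u : box K) g (boxval u) * \1_(X @^-1` [set boxval u]) w.

Lemma box_partE g K w (u : box K) : X w = boxval u -> box_part g K w = g (X w).
Proof.
move=> Xw; rewrite /box_part (bigD1 u)//= indicE mem_set// mulr1 Xw big1 ?addr0//.
move=> u' u'u; rewrite indicE memNset ?mulr0//= Xw => /boxval_inj uu.
by rewrite uu eqxx in u'u.
Qed.

Lemma box_part0 g K w : (forall u : box K, X w <> boxval u) -> box_part g K w = 0.
Proof.
move=> Xw; rewrite /box_part big1// => u _.
by rewrite indicE memNset ?mulr0//=; exact: Xw.
Qed.

Lemma box_part_norm_le g h K w : (forall k, `|g k| <= h k) ->
  `|box_part g K w| <= h (X w).
Proof.
move=> gh; have [[u Xw]|/forallNP Xw] := pselect (exists u : box K, X w = boxval u).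
  by rewrite (box_partE _ Xw).
by rewrite box_part0// normr0 (le_trans _ (gh _)).
Qed.

Lemma box_part_cvg g w : (box_part g K w)%:E @[K --> \oo] --> (g (X w))%:E.
Proof.
apply: cvg_near_cst; exists (`|X w|%N).+1 => // K /= XK.
by have [u Xu] := mem_box XK; rewrite (box_partE g (esym Xu)).
Qed.

Lemma measurable_box_part g K :
  measurable_fun [set: T] (EFin \o box_part g K).
Proof.
have [G GE] : exists G : int -> R, forall w, box_part g K w = G (X w).
  exists (fun k => \sum_(u : box K) g (boxval u) * (k == boxval u)%:R) => w.
  apply: eq_bigr => u _; congr (_ * _); rewrite indicE; congr (_%:R).
  by congr nat_of_bool; apply/idP/eqP; rewrite inE.
by rewrite (funext GE); exact: measurable_int_comp.
Qed.

Lemma integral_box_part g K :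
  (\int[P]_w (box_part g K w)%:E)%E =
  (\sum_(u : box K) mass (boxval u) * g (boxval u))%:E.
Proof.
under eq_integral do rewrite -sumEFin.
have ii (u : box K) : P.-integrable [set: T]
    (EFin \o \1_(X @^-1` [set boxval u])).
  by apply: integrable_indic => //; exact: measurable_preim.
rewrite (integral_sum _ (fun u : box K => integrableZl measurableT
  (g (boxval u)) (ii u)))//.
rewrite -sumEFin; apply: eq_bigr => u _.
rewrite integralZl// integral_indic//; last exact: measurable_preim.
by rewrite setIT mulrC EFinM massE.
Qed.

Section dominated.
Variables (h : int -> R) (c : R).
Hypothesis h_ge0 : forall k, 0 <= h k.
Hypothesis h_sum : forall K, \sum_(u : box K) mass (boxval u) * h (boxval u) <= c.

(** Monotone convergence along growing boxes. *)
Lemma integrable_box_dominated :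
  P.-integrable [set: T] (fun w => (h (X w))%:E).
Proof.
apply/integrableP; split; first exact: measurable_int_comp.
have hn w : (`|(h (X w))%:E| = (h (X w))%:E)%E by rewrite /= ger0_norm.
under eq_integral do rewrite hn.
have b0 K w : 0 <= box_part h K w.
  by apply: sumr_ge0 => u _; rewrite mulr_ge0.
have -> : (\int[P]_w (h (X w))%:E =
    limn (fun K => \int[P]_w (box_part h K w)%:E))%E.
  rewrite -monotone_convergence//.
  - by apply: eq_integral => w _; apply/esym/cvg_lim => //; exact: box_part_cvg.
  - by move=> K; exact: measurable_box_part.
  - by move=> K w _; rewrite lee_fin.
  - move=> w _ K K' KK; rewrite lee_fin.
    apply: (@le_sum_box _ _ _ (fun k => h k * \1_(X @^-1` [set k]) w)) => // k.
    by rewrite mulr_ge0.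
apply: (@le_lt_trans _ _ c%:E); last exact: ltry.
apply: lime_le.
  apply: ereal_nondecreasing_is_cvgn => K K' KK; rewrite !integral_box_part lee_fin.
  apply: (@le_sum_box _ _ _ (fun k => mass k * h k)) => // k.
  by rewrite mulr_ge0// mass_ge0.
by near=> K; rewrite integral_box_part lee_fin.
Unshelve. all: by end_near. Qed.

Lemma cvg_box_expectation (g : int -> R) : (forall k, `|g k| <= h k) ->
  (\sum_(u : box K) mass (boxval u) * g (boxval u)) @[K --> \oo] -->
  fine ('E_P[fun w => g (X w)])%E.
Proof.
move=> gh; rewrite expectation.unlock.
have bnd : {ae P, forall w K, [set: T] w ->
    (`|(box_part g K w)%:E| <= (h (X w))%:E)%E}.
  by apply: aeW => w K _; rewrite lee_fin; exact: box_part_norm_le.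
have cvw : {ae P, forall w, [set: T] w ->
    (box_part g K w)%:E @[K --> \oo] --> (g (X w))%:E}.
  by apply: aeW => w _; exact: box_part_cvg.
have [ig _ cg] := @dominated_convergence _ _ _ P _ measurableT
  (fun K w => (box_part g K w)%:E) (fun w => (g (X w))%:E)
  (fun w => (h (X w))%:E) (fun K => measurable_box_part g K)
  (measurable_int_comp g) cvw integrable_box_dominated bnd.
have E0 : (\int[P]_w (g (X w))%:E)%E \is a fin_num by exact: integrable_fin_num.
rewrite -(fineK E0) in cg.
move/fine_cvg: cg; rewrite (_ : fine \o _ = fun K =>
  \sum_(u : box K) mass (boxval u) * g (boxval u)); last first.
  by apply/funext => K; rewrite /= integral_box_part.
exact.
Qed.

End dominated.
End integer_valued.

Section sequences_of_reals.
Context {R : realType}.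

Lemma cvg_le_bound (x : nat -> R) (l b : R) (K0 : nat) :
  x @ \oo --> l -> (forall K, (K0 <= K)%N -> x K <= b) -> l <= b.
Proof.
move=> xl xb; rewrite -(cvg_lim (@Rhausdorff R) xl).
apply: limr_le; first by apply/cvg_ex; exists l.
by exists K0.
Qed.

Lemma cvg_ge_bound (x : nat -> R) (l b : R) (K0 : nat) :
  x @ \oo --> l -> (forall K, (K0 <= K)%N -> b <= x K) -> b <= l.
Proof.
move=> xl xb; rewrite -(cvg_lim (@Rhausdorff R) xl).
apply: limr_ge; first by apply/cvg_ex; exists l.
by exists K0.
Qed.

Lemma cvg_dist_le (x : nat -> R) (l e : R) : x @ \oo --> l -> 0 < e ->
  exists K0, forall K, (K0 <= K)%N -> `|x K - l| <= e.
Proof.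
move=> /cvgrPdist_le xl e0; have [K0 _ H] := xl _ e0.
by exists K0 => K /H /=; rewrite distrC.
Qed.

Lemma sqr_le_expR (x : R) : 0 <= x -> x ^+ 2 <= 2 * expR x.
Proof.
move=> x0; have := expR_ge1Dxn 1 x0; rewrite /= (_ : 2`!%:R = 2 :> R)//.
by lra.
Qed.

Lemma cube_le_expR6 (x : R) : 0 <= x -> x ^+ 3 <= 6 * expR x.
Proof.
move=> x0; have := expR_ge1Dxn 2 x0; rewrite /= (_ : 3`!%:R = 6 :> R)//.
by lra.
Qed.

End sequences_of_reals.

(** In the section below, [mu] bounds the means, [S] the variances and [M] the
    third moments tilted by [tau]; half of the exponent [delta] is left to
    absorb the polynomial factors.  The sequence [a'] bounds from below the
    tilted masses [P (X = k) exp (t (k - E X))] for all [|t| <= tau] at once; it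
    has the same support as [a]. *)
Section uniform_step.
Context {R : realType}.
Variables (delta c0 : R) (a : int -> R).
Hypotheses (delta_gt0 : 0 < delta) (a_ge0 : forall i, 0 <= a i).

Let c := Num.max c0 1.
Let mu := 2 * c / delta.
Let tau := delta / 2.
Let S := 2 / delta ^+ 2 * expR (delta * mu) * (2 * c).
Let M := 6 / tau ^+ 3 * expR (delta * mu) * (2 * c).
Let a' k : R := a k * expR (- (tau * (`|k%:~R| + mu))).

Let c_ge1 : 1 <= c. Proof. by rewrite le_max lexx orbT. Qed.
Let mu_ge0 : 0 <= mu.
Proof. by rewrite divr_ge0 ?(ltW delta_gt0)// mulr_ge0// (le_trans _ c_ge1). Qed.
Let tau_gt0 : 0 < tau. Proof. by rewrite divr_gt0. Qed.

Section law.
Context {d : measure_display} {T : measurableType d}.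
Variables (P : probability T R) (X : {RV P >-> int}).
Hypothesis X_law : step_laws delta c0 a (distribution P X).

Local Notation p := (mass X).
Let m := fine ('E_P[fun w => (X w)%:~R : R])%E.
Let s := fine ('V_P[fun w => (X w)%:~R : R])%E.

Lemma le_mass k : a k <= p k.
Proof. by rewrite -lee_fin massE; case: X_law => _; apply. Qed.

Lemma box_exp_le K t : `|t| <= delta ->
  \sum_(u : box K) p (boxval u) * expR (t * (boxval u)%:~R) <= c0.
Proof.
move=> td; rewrite -lee_fin; case: X_law => + _; apply: le_trans.
apply: le_trans; last by apply: ereal_sup_ubound; exists t.
rewrite /exp_moment; apply: esum_ge.
exists [set` [seq boxval u | u <- index_enum (box K : finType)]].
  by split => //; exact: finite_seq.
rewrite -fsbig_seq; last first.
  by rewrite (map_inj_uniq (@boxval_inj K)) index_enum_uniq.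
rewrite big_map -sumEFin le_eqVlt; apply/orP; left; apply/eqP.
by apply: eq_bigr => u _; rewrite EFinM massE.
Qed.

Lemma box_exp_abs_le K :
  \sum_(u : box K) p (boxval u) * expR (delta * `|(boxval u)%:~R|) <= 2 * c.
Proof.
have dd : `|delta| <= delta by rewrite ger0_norm// ltW.
have dd' : `|- delta| <= delta by rewrite normrN.
have h1 := box_exp_le K dd; have h2 := box_exp_le K dd'.
have c0c : c0 <= c by rewrite le_max lexx.
apply: (@le_trans _ _ (c0 + c0)); last by lra.
apply: le_trans (lerD h1 h2); rewrite -big_split/=; apply: ler_sum => u _.
rewrite -mulrDr ler_wpM2l ?mass_ge0//.
case: (ger0P ((boxval u)%:~R : R)) => k0.
  by rewrite lerDl expR_ge0.
by rewrite mulrN mulNr lerDr expR_ge0.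
Qed.

Lemma cvg_box_exp (C : R) (g : int -> R) : 0 <= C ->
  (forall k, `|g k| <= C * expR (delta * `|k%:~R|)) ->
  (\sum_(u : box K) p (boxval u) * g (boxval u)) @[K --> \oo] -->
  fine ('E_P[fun w => g (X w)])%E.
Proof.
move=> C0 gC; apply: (cvg_box_expectation (c := C * (2 * c))) gC.
  by move=> k; rewrite mulr_ge0 ?expR_ge0.
move=> K; under eq_bigr do rewrite mulrCA.
by rewrite -mulr_sumr ler_wpM2l// box_exp_abs_le.
Qed.

Lemma box_sum_le (C : R) (g : int -> R) K : 0 <= C ->
  (forall k, g k <= C * expR (delta * `|k%:~R|)) ->
  \sum_(u : box K) p (boxval u) * g (boxval u) <= C * (2 * c).
Proof.
move=> C0 gC; apply: (@le_trans _ _ (\sum_(u : box K) p (boxval u) *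
    (C * expR (delta * `|(boxval u)%:~R|)))).
  by apply: ler_sum => u _; rewrite ler_wpM2l ?mass_ge0.
under eq_bigr do rewrite mulrCA.
by rewrite -mulr_sumr ler_wpM2l// box_exp_abs_le.
Qed.

Let id_le (k : int) : `|k%:~R| <= delta^-1 * expR (delta * `|k%:~R|) :> R.
Proof.
rewrite mulrC ler_pdivlMr// mulrC.
by have := expR_ge1Dx (delta * `|k%:~R|); lra.
Qed.

Lemma cvg_box_mass : (\sum_(u : box K) p (boxval u)) @[K --> \oo] --> (1 : R).
Proof.
have := @cvg_box_exp 1 (fun=> 1) ler01 _.
rewrite expectation_cst/=; under eq_fun do under eq_bigr do rewrite mulr1.
apply => k; rewrite normr1 mul1r -expR0 ler_expR mulr_ge0// ltW//.
Qed.

Lemma box_mass_le1 K : \sum_(u : box K) p (boxval u) <= 1.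
Proof.
apply: (cvg_ge_bound (K0 := K) cvg_box_mass) => K' KK.
by apply: (@le_sum_box _ _ _ p) => // k; exact: mass_ge0.
Qed.

Lemma cvg_box_mean :
  (\sum_(u : box K) p (boxval u) * (boxval u)%:~R) @[K --> \oo] --> m.
Proof.
by apply: (@cvg_box_exp delta^-1 (fun k => k%:~R)); rewrite ?invr_ge0 ?ltW.
Qed.

Lemma norm_mean_le : `|m| <= mu.
Proof.
apply: (cvg_le_bound (K0 := 0%N) (cvg_norm cvg_box_mean)) => K _.
apply: (le_trans (ler_norm_sum _ _ _)).
under eq_bigr do rewrite normrM (ger0_norm (mass_ge0 _ _)).
have d0 : 0 <= delta^-1 by rewrite invr_ge0 ltW.
have := @box_sum_le _ (fun k => `|k%:~R|) K d0 id_le.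
by rewrite /mu [_ / delta]mulrC.
Qed.

Let exp_centred (k : int) :
  expR (delta * `|k%:~R - m|) <= expR (delta * mu) * expR (delta * `|k%:~R|).
Proof.
rewrite -expRD ler_expR -mulrDr ler_wpM2l ?(ltW delta_gt0)// [leRHS]addrC.
by rewrite (le_trans (ler_normB _ _))// lerD2l norm_mean_le.
Qed.

Let sqr_centred (k : int) : (k%:~R - m) ^+ 2 <=
  2 / delta ^+ 2 * expR (delta * mu) * expR (delta * `|k%:~R|).
Proof.
have d0 : 0 <= delta * `|k%:~R - m| by rewrite mulr_ge0// ltW.
have := sqr_le_expR d0.
rewrite exprMn real_normK ?num_real// => h.
rewrite -(ler_pM2l (exprn_gt0 2 delta_gt0)) (le_trans h)//.
rewrite [leRHS](_ : _ = 2 * (expR (delta * mu) * expR (delta * `|k%:~R|))).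
  by rewrite ler_wpM2l.
by field; rewrite gt_eqF.
Qed.

Lemma cvg_box_variance :
  (\sum_(u : box K) p (boxval u) * ((boxval u)%:~R - m) ^+ 2) @[K --> \oo]
    --> s.
Proof.
have -> : s = fine ('E_P[fun w => (((X w)%:~R - m) ^+ 2)%R])%E.
  rewrite /s /variance covariance.unlock.
  by apply: (congr1 (fun f : T -> R => fine (expectation P f))).
apply: (@cvg_box_exp (2 / delta ^+ 2 * expR (delta * mu))
  (fun k => (k%:~R - m) ^+ 2)).
  by rewrite mulr_ge0 ?expR_ge0// divr_ge0// sqr_ge0.
by move=> k; rewrite ger0_norm ?sqr_ge0.
Qed.

Lemma box_third_le K : \sum_(u : box K) p (boxval u) *
  (`|(boxval u)%:~R - m| ^+ 3 * expR (tau * `|(boxval u)%:~R - m|)) <= M.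
Proof.
apply: (@box_sum_le (6 / tau ^+ 3 * expR (delta * mu))
  (fun k => `|k%:~R - m| ^+ 3 * expR (tau * `|k%:~R - m|))).
  by rewrite mulr_ge0 ?expR_ge0// divr_ge0// exprn_ge0// ltW.
move=> k; have t0 : 0 <= tau * `|k%:~R - m| by rewrite mulr_ge0// ltW.
have := cube_le_expR6 t0; rewrite exprMn => h.
rewrite -(ler_pM2l (exprn_gt0 3 tau_gt0)) mulrA.
apply: (le_trans (ler_wpM2r (expR_ge0 _) h)).
have -> : 6 * expR (tau * `|k%:~R - m|) * expR (tau * `|k%:~R - m|) =
    6 * expR (delta * `|k%:~R - m|).
  by rewrite -mulrA -expRD; congr (_ * expR _); rewrite /tau; field.
rewrite [leRHS](_ : _ = 6 * (expR (delta * mu) * expR (delta * `|k%:~R|))).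
  by rewrite ler_wpM2l.
by field; rewrite gt_eqF.
Qed.

Variables (Cs : R) (N : nat).
Hypotheses (Cs_gt0 : 0 < Cs)
  (a'_spread : forall th, 1 - cos th <= Cs * spread a' N th).

Let a'_le (t : R) (k : int) : `|t| <= tau ->
  0 <= a' k <= p k * expR (t * (k%:~R - m)).
Proof.
move=> tt; rewrite mulr_ge0 ?expR_ge0//= ler_pM ?expR_ge0 ?le_mass//.
rewrite ler_expR lerNl -mulrN.
apply: (le_trans (ler_norm _)); rewrite normrM normrN ler_pM//.
by rewrite (le_trans (ler_normB _ _))// lerD2l norm_mean_le.
Qed.

Lemma box_spread_ge K t th : (N <= K)%N -> `|t| <= tau -> `|th| <= pi ->
  (32 * Cs)^-1 * th ^+ 2 <= tilt_spread (fun u : box K => p (boxval u))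
    (fun u => (boxval u)%:~R - m) t th.
Proof.
move=> NK tt thpi.
have -> : tilt_spread (fun u : box K => p (boxval u))
    (fun u => (boxval u)%:~R - m) t th =
    spread (fun k => p k * expR (t * (k%:~R - m))) K th.
  apply: eq_bigr => u _; apply: eq_bigr => w _.
  by rewrite rmorphB/=; congr (_ * (1 - cos (_ * _))); ring.
have h1 := le_spread th NK (fun k => a'_le k tt).
have h2 := one_sub_cos_ge thpi; have h3 := a'_spread th.
have h4 : th ^+ 2 / 32 <= Cs * spread a' N th by exact: le_trans h3.
apply: le_trans h1; rewrite -(ler_pM2l Cs_gt0) (le_trans _ h4)//.
by rewrite le_eqVlt; apply/orP; left; apply/eqP; field; rewrite gt_eqF.
Qed.

(** [E (X - X')^2 = 2 Var X] for an independent copy [X'], and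
    [1 - cos u <= u^2 / 2] bounds it from below by the spread at [th = 1]. *)
Lemma variance_ge : (64 * Cs)^-1 <= s.
Proof.
apply: (cvg_ge_bound (K0 := N) cvg_box_variance) => K NK.
set V := \sum_u _.
have tau0 : `|0 : R| <= tau by rewrite normr0 ltW.
have pi1 : `|1 : R| <= pi by rewrite normr1; have := @pi_ge2 R; lra.
have := box_spread_ge NK tau0 pi1; rewrite expr1n mulr1 => h.
suff : tilt_spread (fun u : box K => p (boxval u))
    (fun u => (boxval u)%:~R - m) 0 1 <= 2 * V.
  move/(le_trans h); rewrite !invfM; lra.
rewrite /tilt_spread.
apply: (@le_trans _ _ (\sum_(u : box K) \sum_(w : box K)
   (p (boxval u) * ((boxval u)%:~R - m) ^+ 2 * p (boxval w) +
    p (boxval u) * (p (boxval w) * ((boxval w)%:~R - m) ^+ 2)))).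
  apply: ler_sum => u _; apply: ler_sum => w _.
  rewrite !mul0r expR0 !mulr1 mul1r.
  set x := _ - m; set y := _ - m.
  have : p (boxval u) * p (boxval w) * (1 - cos (x - y)) <=
     p (boxval u) * p (boxval w) * (x ^+ 2 + y ^+ 2).
    rewrite ler_wpM2l ?mulr_ge0 ?mass_ge0//.
    rewrite (le_trans (one_sub_cos_le _))//.
    have : 0 <= (x + y) ^+ 2 by rewrite sqr_ge0.
    by rewrite sqrrB sqrrD; lra.
  by lra.
have V0 : 0 <= V.
  by apply: sumr_ge0 => u _; rewrite mulr_ge0 ?mass_ge0 ?sqr_ge0.
under eq_bigr do rewrite big_split/= -mulr_sumr -mulr_sumr.
rewrite big_split/= -!mulr_suml -/V.
have l1 := box_mass_le1 K.
have : V * (\sum_(u : box K) p (boxval u)) <= V * 1 by rewrite ler_wpM2l.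
by lra.
Qed.

(** The constants do not depend on the law; only the size of the box does. *)
Lemma regular_box_step e : 0 < e -> exists K0, forall K, (K0 <= K)%N ->
  regular_step (fun u : box K => p (boxval u))
    (fun u => (boxval u)%:~R - m) s e tau S M (32 * Cs)^-1 (64 * Cs)^-1.
Proof.
move=> e0.
have cm : (\sum_(u : box K) p (boxval u) * ((boxval u)%:~R - m)) @[K --> \oo]
    --> (0 : R).
  rewrite [X in X @ _](_ : _ = fun K => (\sum_(u : box K) p (boxval u) *
    (boxval u)%:~R) - (\sum_(u : box K) p (boxval u)) * m); last first.
    apply/funext => K; rewrite mulr_suml -sumrB.
    by apply: eq_bigr => u _; rewrite mulrBr.
  rewrite [X in _ --> X](_ : 0 = m - 1 * m); last by rewrite mul1r subrr.
  by apply: (cvgB cvg_box_mean); apply: (cvgM cvg_box_mass); exact: cvg_cst.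
have [K1 h1] := cvg_dist_le cvg_box_mass e0.
have [K2 h2] := cvg_dist_le cm e0.
have [K3 h3] := cvg_dist_le cvg_box_variance e0.
exists (maxn (maxn K1 K2) (maxn K3 N)) => K.
rewrite !geq_max => /andP[/andP[l1 l2] /andP[l3 l4]].
split.
- by move=> u; exact: mass_ge0.
- exact: h1.
- by have := h2 _ l2; rewrite subr0.
- exact: h3.
- exact: box_third_le.
- rewrite variance_ge/=; apply: (cvg_le_bound (K0 := 0%N) cvg_box_variance) => K' _.
  apply: (@box_sum_le _ (fun k => (k%:~R - m) ^+ 2)) => //.
  by rewrite mulr_ge0 ?expR_ge0// divr_ge0// sqr_ge0.
- by move=> t th; exact: box_spread_ge.
Qed.

End law.

Hypothesis a_irr : irreducible_aperiodic_seq a.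

(** Positive weights do not change the support, so the same [p] witnesses that
    [a'] is irreducible and aperiodic. *)
Lemma damped_seq_spread :
  exists (C : R) (N : nat), 0 < C /\ forall th, 1 - cos th <= C * spread a' N th.
Proof.
apply: aperiodic_spread; first by move=> i; rewrite mulr_ge0 ?expR_ge0.
case: a_irr => p [irr aper [b [b0 ab]]]; exists p; split => //.
exists (fun k => b k * expR (- (tau * (`|k%:~R| + mu)))); split.
  by move=> i; rewrite mulr_gt0 ?expR_gt0.
by move=> i; rewrite /a' [a i * _]mulrC EFinM ab muleA -EFinM mulrC.
Qed.

Lemma uniform_regular_step : exists tau S M kappa v : R,
  [/\ 0 < tau, 0 <= S, 0 <= M, 0 < kappa & 0 < v] /\
  forall (d : measure_display) (T : measurableType d) (P : probability T R)
    (X : {RV P >-> int}),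
    step_laws delta c0 a (distribution P X) ->
    forall e, 0 < e -> exists K0, forall K, (K0 <= K)%N ->
      regular_step (fun u : box K => mass X (boxval u))
        (fun u => (boxval u)%:~R - fine ('E_P[fun w => (X w)%:~R : R])%E)
        (fine ('V_P[fun w => (X w)%:~R : R])%E) e tau S M kappa v.
Proof.
have [C [N [C0 spr]]] := damped_seq_spread.
exists tau, S, M, (32 * C)^-1, (64 * C)^-1; split; last first.
  by move=> d T P X Xlaw e e0; exact: (regular_box_step Xlaw C0 spr).
have c2 : 0 <= 2 * c by rewrite mulr_ge0// (le_trans _ c_ge1).
split; rewrite ?invr_gt0 ?mulr_gt0//.
- apply: mulr_ge0 => //; apply: mulr_ge0; last exact: expR_ge0.
  by rewrite divr_ge0// sqr_ge0.
- apply: mulr_ge0 => //; apply: mulr_ge0; last exact: expR_ge0.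
  by rewrite divr_ge0// exprn_ge0// ltW.
Qed.

End uniform_step.

(** * The walk in a box *)

Section walk_in_box.
Context {R : realType} {d : measure_display} {T : measurableType d}.
Variables (P : probability T R) (X : nat -> {RV P >-> int}).
Hypothesis X_indep : mutually_independent X.
Variables (n : nat) (y : int).

Definition path_event K (f : {ffun 'I_n -> box K}) : set T :=
  [set w | forall j : 'I_n, X j w = boxval (f j)].

(** The form to which mutual independence applies; the index set [iota 0 n] is
    made of natural numbers, so the ordinal [j] is quantified over. *)
Lemma path_eventE K (f : {ffun 'I_n -> box K}) :
  path_event f = \bigcap_(i in [set` [fset i in iota 0 n]%fset])
    (X i @^-1` [set k | forall j : 'I_n, (j : nat) = i -> k = boxval (f j)]).
Proof.
apply/seteqP; split => w /= H.
  by move=> i _ j ji; rewrite -ji H.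
move=> j; apply: (H j) => //=.
by rewrite !inE/= mem_iota/= add0n.
Qed.

Lemma measurable_path_event K (f : {ffun 'I_n -> box K}) :
  measurable (path_event f).
Proof.
rewrite path_eventE; apply: fin_bigcap_measurable; first exact: finite_fset.
by move=> i _; exact: measurable_preim.
Qed.

Lemma path_event_prob K (f : {ffun 'I_n -> box K}) :
  P (path_event f) = (\prod_(j < n) mass (X j) (boxval (f j)))%:E.
Proof.
rewrite path_eventE X_indep// -prodEFin.
rewrite (perm_big (iota 0 n)); last first.
  apply: uniq_perm; [exact: fset_uniq|exact: iota_uniq|move=> i].
  by rewrite !inE.
rewrite -[in iota 0 n](subn0 n) -/(index_iota 0 n) big_mkord.
apply: eq_bigr => j _; rewrite massE; congr (P _).
apply/seteqP; split => w /= => [H|-> j' /val_inj -> //].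
exact: H.
Qed.

Definition walk_box_event K : set T :=
  \bigcup_(f in [set f : {ffun 'I_n -> box K} | \sum_j boxval (f j) = y])
    path_event f.

Lemma measurable_walk_box_event K : measurable (walk_box_event K).
Proof.
apply: fin_bigcup_measurable; first exact: finite_finset.
by move=> f _; exact: measurable_path_event.
Qed.

Lemma walk_box_event_prob K : P (walk_box_event K) =
  (\sum_(f : {ffun 'I_n -> box K} | \sum_j boxval (f j) == y)
     \prod_(j < n) mass (X j) (boxval (f j)))%:E.
Proof.
rewrite /walk_box_event content_fin_bigcup.
- rewrite (_ : [set f | _] = [set` [seq f : {ffun 'I_n -> box K} <- index_enum
    ({ffun 'I_n -> box K} : finType) | \sum_j boxval (f j) == y]]).
    rewrite -fsbig_seq ?filter_uniq ?index_enum_uniq// big_filter -sumEFin.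
    by apply: eq_bigr => f _; exact: path_event_prob.
  apply/seteqP; split => f /=; rewrite mem_filter mem_index_enum andbT.
    by move=> ->.
  by move/eqP.
- exact: finite_finset.
- move=> f g _ _ [w [/= wf wg]]; apply/ffunP => j; apply: boxval_inj.
  by rewrite -wf.
- by move=> f _; exact: measurable_path_event.
- exact: measurable_walk_box_event.
Qed.

Lemma bigcup_walk_box_event :
  \bigcup_K walk_box_event K = [set w | walk 0 X n w = y].
Proof.
apply/seteqP; split => w.
  move=> [K _ [f /= <- wf]]; rewrite /walk/= add0r.
  by apply: eq_bigr => j _; rewrite wf.
rewrite /walk/= add0r => wy.
pose K := (\max_(j < n) `|X j w|%N).+1.
have in_box (j : 'I_n) : exists u : box K, boxval u = X j w.
  by apply: mem_box; rewrite ltnS (leq_bigmax j).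
have [u uE] := fin_all_exists in_box.
exists K => //; exists [ffun j => u j]; last by move=> j; rewrite ffunE.
by rewrite /= -wy; apply: eq_bigr => j _; rewrite ffunE.
Qed.

Lemma walk_box_event_mono K K' : (K <= K')%N ->
  walk_box_event K `<=` walk_box_event K'.
Proof.
move=> KK w [f /= fy wf].
pose g := [ffun j => ((f j).1, widen_ord KK (f j).2)].
have gf j : boxval (g j) = boxval (f j) by rewrite ffunE.
exists g => /= [|j]; last by rewrite gf.
by rewrite -fy; apply: eq_bigr.
Qed.

(** The paths that stay in a box exhaust all paths as the box grows. *)
Lemma cvg_walk_box :
  (\sum_(f : {ffun 'I_n -> box K} | \sum_j boxval (f j) == y)
     \prod_(j < n) mass (X j) (boxval (f j))) @[K --> \oo] -->
  fine (P [set w | walk 0 X n w = y]).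
Proof.
have mU : measurable (\bigcup_K walk_box_event K).
  by apply: bigcup_measurable => K _; exact: measurable_walk_box_event.
have mono : {homo walk_box_event : K K' / (K <= K')%N >-> (K <= K')%O}.
  by move=> K K' KK; apply/subsetPset; exact: walk_box_event_mono.
have cE := @nondecreasing_cvg_mu _ _ _ P _ measurable_walk_box_event mU mono.
rewrite bigcup_walk_box_event in cE mU.
have {}cE : (P \o walk_box_event) K @[K --> \oo] -->
    (fine (P [set w | walk 0 X n w = y]))%:E.
  by rewrite fineK ?fin_num_measure.
move/fine_cvg: cE.
rewrite (_ : fine \o _ = fun K =>
  \sum_(f : {ffun 'I_n -> box K} | \sum_j boxval (f j) == y)
     \prod_(j < n) mass (X j) (boxval (f j))); last first.
  by apply/funext => K; rewrite /= walk_box_event_prob.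
exact.
Qed.

End walk_in_box.

(** * The error rate and the theorem *)

Section rate.
Context {R : realType}.
Implicit Types alpha gamma v eta : R.

Lemma powR_natE (n : nat) (z : R) : (0 < n)%N ->
  n%:R `^ z = expR (z * ln n%:R).
Proof. by move=> n0; rewrite /powR pnatr_eq0 gtn_eqF. Qed.

Lemma exists_powR_le gamma eta : 0 < gamma -> 0 < eta ->
  exists n0, (1 <= n0)%N /\
    forall n, (n0 <= n)%N -> n%:R `^ (- gamma) <= eta.
Proof.
move=> g0 eta0; exists (Num.bound (expR (- ln eta / gamma))).+1; split=> // n n0n.
have n0 : (0 < n)%N by exact: leq_trans n0n.
rewrite powR_natE// -[leRHS]lnK ?posrE// ler_expR mulNr lerNl mulrC -ler_pdivrMr//.
have := archi_boundP (expR_ge0 (- ln eta / gamma)) => h.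
rewrite -ler_expR lnK ?posrE ?ltr0n// (le_trans (ltW h))// ler_nat.
exact: ltnW.
Qed.

(** With [l = ln n] each bound compares two multiples of [l].  The first uses
    [alpha - 1 <= - 1 / 3], the second [3 alpha - 2 <= - gamma]. *)
Lemma rate_bounds alpha v x B (n : nat) :
  let gamma := Num.min (2 - 3 * alpha) (1 / 3) in
  let r := n%:R `^ (- gamma) in
  0 <= alpha < 2 / 3 -> 0 < v -> (0 < n)%N -> v * n%:R <= B ->
  `|x| <= n%:R `^ alpha ->
  [/\ `|x / B| <= r / v, n%:R * `|x / B| ^+ 3 <= r / v ^+ 3,
      (Num.sqrt n%:R)^-1 <= r & r <= 1].
Proof.
move=> gamma r /andP[a0 a23] v0 n0 vB xn.
have gm1 : gamma <= 2 - 3 * alpha by rewrite ge_min lexx.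
have gm2 : gamma <= 1 / 3 by rewrite ge_min lexx orbT.
have g0 : 0 <= gamma by rewrite le_min; apply/andP; split; lra.
have npos : 0 < n%:R :> R by rewrite ltr0n.
pose l : R := ln n%:R.
have l0 : 0 <= l by rewrite ln_ge0// ler1n.
have nE : n%:R = expR l by rewrite lnK// posrE.
have rE : r = expR (- gamma * l) by rewrite /r powR_natE.
have mono u w : u <= w -> expR (u * l) <= expR (w * l).
  by move=> uw; rewrite ler_expR ler_wpM2r.
have B0 : 0 < B by rewrite (lt_le_trans _ vB)// mulr_gt0.
have tE : `|x / B| <= expR ((alpha - 1) * l) / v.
  rewrite normrM normfV (gtr0_norm B0).
  apply: (@le_trans _ _ (n%:R `^ alpha / (v * n%:R))).
    by rewrite ler_pM ?invr_ge0 ?(ltW B0)// lef_pV2 ?posrE ?mulr_gt0.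
  rewrite powR_natE// -/l nE mulrBl mul1r expRB le_eqVlt; apply/orP; left.
  by apply/eqP; field; rewrite (gt_eqF v0) (gt_eqF (expR_gt0 l)).
have iv : 0 <= v^-1 by rewrite invr_ge0 ltW.
split.
- rewrite (le_trans tE)// ler_wpM2r// rE mono//; lra.
- apply: (@le_trans _ _ (n%:R * (expR ((alpha - 1) * l) / v) ^+ 3)).
    by rewrite ler_wpM2l ?ler0n// lerXn2r ?nnegrE ?mulr_ge0 ?expR_ge0.
  rewrite exprMn exprVn mulrA ler_wpM2r ?invr_ge0 ?exprn_ge0 ?(ltW v0)//.
  rewrite nE -expRM_natl -expRD rE ler_expR.
  have : (1 + 3 * (alpha - 1)) * l <= - gamma * l by rewrite ler_wpM2r//; lra.
  by lra.
- rewrite rE; have -> : (Num.sqrt n%:R)^-1 = expR (- (1 / 2) * l).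
    have -> : n%:R = expR (1 / 2 * l) ^+ 2.
      by rewrite -expRM_natl nE; congr expR; field.
    by rewrite sqrtr_sqr ger0_norm ?expR_ge0// -expRN mulNr.
  by apply: mono; lra.
- by rewrite rE -expR0 -(mul0r l) mono// oppr_le0.
Qed.

Lemma between_expR (Q e : R) : 0 <= e <= 1 / 2 -> `|Q - 1| <= e ->
  expR (- (2 * e)) <= Q <= expR (2 * e).
Proof.
move=> /andP[e0 e2]; rewrite ler_norml => /andP[h1 h2]; apply/andP; split.
  apply: (@le_trans _ _ (1 - e)); last by move: h1; lra.
  have E1 := expR_ge1Dx (2 * e).
  rewrite expRN invf_ple ?posrE ?expR_gt0//; last by lra.
  apply: le_trans E1; rewrite -[leLHS]mul1r ler_pdivrMr; last by lra.
  have : 0 <= e * (1 - 2 * e) by rewrite mulr_ge0//; lra.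
  by lra.
by have := expR_ge1Dx (2 * e); lra.
Qed.

End rate.

Theorem theorem4p1 (R : realType) (delta0 c0 : R) (a : int -> R) (alpha : R)
    (delta0_gt0 : 0 < delta0)
    (a01 : forall i, 0 <= a i <= 1)
    (a_irr : irreducible_aperiodic_seq a)
    (alpha_ge0 : 0 <= alpha) (alpha_lt : alpha < 2 / 3) :
  exists (n0 : nat) (C : R), [/\ (1 <= n0)%N, 0 <= C &
    forall (d : measure_display) (T : measurableType d) (P : probability T R)
      (X : nat -> {RV P >-> int}),
      mutually_independent X ->
      (forall i, step_laws delta0 c0 a (distribution P (X i))) ->
      forall (n : nat) (y : int), (n0 <= n)%N ->
        `|y%:~R - walk_mean X n| <= n%:R `^ alpha ->
        let err := C * n%:R `^ (- Num.min (2 - 3 * alpha) (1 / 3)) in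
        let B := walk_variance X n in
        expR (- err) <=
          Num.sqrt (2 * pi * B)
          * expR ((y%:~R - walk_mean X n) ^+ 2 / (2 * B))
          * fine (P [set w | walk 0 X n w = y])
          <= expR err].
Proof.
have a0 i : 0 <= a i by case/andP: (a01 i).
have [tau [S [M [kappa [v [[tau0 S0 M0 k0 v0] regular]]]]]] :=
  uniform_regular_step c0 delta0_gt0 a0 a_irr.
have L0 : 0 <= (v ^+ 3)^-1 by rewrite invr_ge0 exprn_ge0// ltW.
have [C1 [C10 llt]] := finite_local_limit k0 v0 (ltW tau0) S0 M0 L0.
set gamma := Num.min (2 - 3 * alpha) (1 / 3).
have g0 : 0 < gamma by rewrite lt_min; apply/andP; split; lra.
set C2 := C1 * ((v ^+ 3)^-1 + 1).
have C20 : 0 <= C2 by rewrite mulr_ge0// addr_ge0.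
have eta0 : 0 < Num.min (2 * (C2 + 1))^-1 (tau * v).
  by rewrite lt_min mulr_gt0// andbT invr_gt0 mulr_gt0// ltr_wpDl.
have [n0 [n01 small]] := exists_powR_le g0 eta0.
exists n0, (2 * C2); split => //; first exact: mulr_ge0.
move=> d T P X X_indep X_law n y n0n yn; lazy zeta.
set r := n%:R `^ (- gamma).
have n_gt0 : (0 < n)%N by exact: leq_trans n0n.
set B := walk_variance X n.
move: (small n n0n); rewrite -/r le_min => /andP[rC rtau].
have e0 : 0 < (n%:R * Num.sqrt n%:R)^-1 :> R.
  by rewrite invr_gt0 mulr_gt0 ?sqrtr_gt0 ?ltr0n.
(* one box size that suits the [n] steps *)
have [K0 regK] := fin_all_exists (fun j : 'I_n => regular _ _ P (X j) (X_law j) _ e0).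
pose Kmax := \max_(j < n) K0 j.
have {}regK K (j : 'I_n) : (Kmax <= K)%N -> _ :=
  fun KK => regK j K (leq_trans (leq_bigmax j) KK).
have vB : v * n%:R <= B.
  rewrite mulr_natr -[X in _ *+ X]card_ord -sumr_const.
  by apply: ler_sum => j _; have [_ _ _ _ _ /andP[]] := regK _ j (leqnn _).
have B0 : 0 < B by rewrite (lt_le_trans _ vB)// mulr_gt0// ltr0n.
have alpha01 : 0 <= alpha < 2 / 3 by rewrite alpha_ge0.
have [] := rate_bounds alpha01 v0 n_gt0 vB yn.
rewrite -/gamma -/r; set t := _ / B => tr ntr nr r1.
have t_tau : `|t| <= tau by rewrite (le_trans tr)// ler_pdivrMr.
have nt_L : n%:R * `|t| ^+ 3 <= (v ^+ 3)^-1.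
  by rewrite (le_trans ntr)// ler_piMl.
have r0 : 0 <= r by exact: powR_ge0.
have err_le : C1 * (n%:R * `|t| ^+ 3 + (Num.sqrt n%:R)^-1) <= C2 * r.
  rewrite /C2 -mulrA ler_wpM2l// mulrDl mul1r lerD//.
  by rewrite [leRHS]mulrC.
set F := Num.sqrt _ * expR _.
have cvQ : `|F * fine (P [set w | walk 0 X n w = y]) - 1| <= C2 * r.
  have cv : `|F * (\sum_(f : {ffun 'I_n -> box K} | \sum_j boxval (f j) == y)
      \prod_(j < n) mass (X j) (boxval (f j))) - 1| @[K --> \oo] -->
      `|F * fine (P [set w | walk 0 X n w = y]) - 1|.
    apply: cvg_norm; apply: cvgB; last exact: cvg_cst.
    by apply: cvgM; [exact: cvg_cst|exact: cvg_walk_box].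
  apply: (cvg_le_bound (K0 := Kmax) cv) => K KK.
  apply: le_trans err_le.
  apply: (llt _ n (fun j u => mass (X j) (boxval u)) (@boxval K)
    (fun j : 'I_n => fine ('E_P[fun w => (X j w)%:~R : R])%E)
    (fun j : 'I_n => fine ('V_P[fun w => (X j w)%:~R : R])%E) t y) => //.
    by move=> j; exact: regK.
  rewrite -/(walk_variance X n) -/(walk_mean X n) -/B /t.
  by rewrite mulrCA divff ?mulr1// gt_eqF.
have := @between_expR _ _ (C2 * r) _ cvQ.
rewrite mulrA; apply; rewrite mulr_ge0//=.
have : C2 * r <= C2 * (2 * (C2 + 1))^-1 by rewrite ler_wpM2l.
move/le_trans; apply; rewrite ler_pdivrMr; last by rewrite mulr_gt0// ltr_wpDl.
by lra.
Qed.
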